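(* For every CPPOS $P$ and every $p\in\operatorname{int}(P)$, $$A^*\bigl(\operatorname{ART}_P(p)\bigr)=\frac12\sum_I\int_I\left(q_p(\theta)^2-q_p'(\theta)^2\right)d\theta\le0,$$ where the sum is over the smooth cells $I$ of the transformed line family (intervals of normal angles in one period $[0,\pi]$). Equality in the inequality holds if and only if the completed $\operatorname{ART}_P(p)$ degenerates to a point.
   Context: A CPPOS (convex polygon with parallel opposite sides) is a positively oriented convex polygon $P=(P_0,\dots,P_{2n-1})$, indices modulo $2n$, all $P_i$ genuine vertices (consecutive edge vectors linearly independent), whose edge vectors $e_i=P_{i+1}-P_i$ satisfy $e_{i+n}\parallel e_i$. $P$ also denotes the closed convex region it bounds. Boundary involution: $\sigma_P(P_i+s e_i)=P_{i+n}+s e_{i+n}$, $0\le s\le1$. For a line $\ell$ meeting $\operatorname{int}(P)$ with boundary intersection points $x_\ell,y_\ell$, $\Phi_P(\ell)=\overline{\sigma_P(x_\ell)\sigma_P(y_\ell)}$. $\Lambda_p$ is the pencil of lines through $p\in\operatorname{int}(P)$; the transformed line family is $\Phi_P(\Lambda_p)$. A cell is a maximal open arc of this family on which the boundary points of the original line lie in two fixed open sides; at a cell transition the original line passes through a vertex. Put $n(\theta)=(\cos\theta,\sin\theta)$, $\tau(\theta)=(-\sin\theta,\cos\theta)$. The normal direction is a global parameter of the family: for each $\theta$ there is exactly one line of $\Phi_P(\Lambda_p)$ with normal $n(\theta)$, written $n(\theta)\cdot(z-p)=q_p(\theta)$, where $q_p$ is continuous, smooth on each cell, has one-sided derivatives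 at transitions, and $q_p(\theta+\pi)=-q_p(\theta)$. The completed affine reflection transform $\operatorname{ART}_P(p)$ is the closed front made of the cellwise envelopes $X(\theta)=p+q_p(\theta)n(\theta)+q_p'(\theta)\tau(\theta)$ and, at each transition angle $\theta_k$, of the oriented segment from $X^-=p+q_pn+q_p'(\theta_k^-)\tau$ to $X^+=p+q_pn+q_p'(\theta_k^+)\tau$, traversed once as $\theta$ runs over one period $\pi$. Its oriented area is $A^*=\frac12\oint[X,dX]$ over the whole completed front, with $[u,v]=\det(u,v)$. *)

(* Defs.v *)
From HB Require Import structures.
From mathcomp Require Import all_boot all_order all_algebra.
From mathcomp Require Import all_classical all_reals all_analysis.

Set Implicit Arguments.
Unset Strict Implicit.
Unset Printing Implicit Defensive.

Import Order.TTheory GRing.Theory Num.Theory.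
Import numFieldNormedType.Exports.

Local Open Scope classical_set_scope.
Local Open Scope ring_scope.

Section Plane.
Variable R : realType.
Implicit Types (u v a b z : R * R) (t : R).

Definition det2 u v : R := u.1 * v.2 - u.2 * v.1.
Definition dot2 u v : R := u.1 * v.1 + u.2 * v.2.

Definition nvec t : R * R := (cos t, sin t).
Definition tvec t : R * R := (- sin t, cos t).

Definition line_through a b : set (R * R) := [set z | det2 (b - a) (z - a) = 0].

Definition pencil (p : R * R) : set (set (R * R)) :=
  [set l | l p /\ exists a b, a <> b /\ l = line_through a b].

Definition normal_line (p : R * R) t (c : R) : set (R * R) :=
  [set z | dot2 (nvec t) (z - p) = c].

Definition lerp a b t : R * R := a + t *: (b - a).

(* 1/2 int [g, dg] = 1/2 int (x dy - y dx) along g restricted to ]a, b[ *)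
Definition arc_area (g : R -> R * R) (a b : R) : R :=
  2^-1 * \int[lebesgue_measure]_(t in `]a, b[)
    ((g t).1 * derive1 (snd \o g) t - (g t).2 * derive1 (fst \o g) t).

Definition left_derivative (f : R -> R) t : R :=
  lim ((fun h => h^-1 * (f (t + h) - f t)) @ 0^'-).
Definition right_derivative (f : R -> R) t : R :=
  lim ((fun h => h^-1 * (f (t + h) - f t)) @ 0^'+).

End Plane.

Section CPPOS.
Variable R : realType.
Implicit Types (P : nat -> R * R) (p x : R * R) (l : set (R * R)) (t : R).

Definition edge P i : R * R := P i.+1 - P i.

(* A polygon with 2n vertices is a 2n-periodic sequence of points.  Vertices
   are distinct and each lies weakly to the left of every side line; together
   with [cppos_vertex] this says that P goes exactly once, counterclockwise,
   around a convex polygon whose set of vertices is {P_0, ..., P_(2n-1)}. *)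
Record cppos (n : nat) P : Prop := Cppos {
  cppos_gt1 : (1 < n)%N;
  cppos_periodic : forall i, P (i + n.*2)%N = P i;
  cppos_inj : forall i j,
    (i < n.*2)%N -> (j < n.*2)%N -> P i = P j -> i = j;
  cppos_convex : forall i j, 0 <= det2 (edge P i) (P j - P i);
  cppos_vertex : forall i, det2 (edge P i) (edge P i.+1) <> 0;
  cppos_parallel : forall i, det2 (edge P i) (edge P (i + n)%N) = 0 }.

Definition region P : set (R * R) :=
  [set z | forall i, 0 <= det2 (edge P i) (z - P i)].

Definition side P i : set (R * R) :=
  [set z | exists s : R, 0 <= s <= 1 /\ z = P i + s *: edge P i].
Definition open_side P i : set (R * R) :=
  [set z | exists s : R, 0 < s < 1 /\ z = P i + s *: edge P i].
Definition boundary P : set (R * R) := [set z | exists i, side P i z].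

Variable n : nat.

(* Single-valued on the boundary: at a vertex the two incident sides agree. *)
Definition sigma P x : R * R :=
  get [set x' | exists i (s : R), 0 <= s <= 1 /\
    x = P i + s *: edge P i /\ x' = P (i + n)%N + s *: edge P (i + n)%N].

(* A line meeting the interior has exactly two boundary points x, y, so the
   existential below only ranges over (x, y) and (y, x). *)
Definition Phi P l : set (R * R) :=
  [set z | exists x y, [/\ x <> y, (boundary P `&` l) x, (boundary P `&` l) y
     & line_through (sigma P x) (sigma P y) z]].

Definition transformed_family P p : set (set (R * R)) := Phi P @` pencil p.

(* For P a cppos and p interior to P, exactly one transformed line has unit
   normal (nvec t), so [get] picks the offset of that line. *)
Definition qfun P p t : R :=
  get [set c | transformed_family P p (normal_line p t c)].

Definition original_line P p t : set (set (R * R)) :=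
  [set l | pencil p l /\ Phi P l = normal_line p t (qfun P p t)].

Definition transition P p : set R :=
  [set t | exists l i, original_line P p t l /\ l (P i)].

Definition fixed_sides P p (a b : R) : Prop :=
  exists i j, forall t, a < t < b -> exists l x y,
    [/\ original_line P p t l, x <> y,
        (open_side P i `&` l) x & (open_side P j `&` l) y].

(* The cells, as intervals ]I.1, I.2[ of the period [0, pi]; an arc having the
   angle 0 = pi (mod pi) in its interior is cut there. *)
Definition cells P p : set (R * R) :=
  [set I | [/\ 0 <= I.1, I.1 < I.2, I.2 <= pi, fixed_sides P p I.1 I.2
     & forall a b, 0 <= a <= I.1 -> I.2 <= b <= pi -> fixed_sides P p a b ->
         (a, b) = I]].

Definition transitions P p : set R := transition P p `&` `[0, pi[%classic.

Definition envelope P p t : R * R :=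
  p + qfun P p t *: nvec t + derive1 (qfun P p) t *: tvec t.
Definition envelope_left P p t : R * R :=
  p + qfun P p t *: nvec t + left_derivative (qfun P p) t *: tvec t.
Definition envelope_right P p t : R * R :=
  p + qfun P p t *: nvec t + right_derivative (qfun P p) t *: tvec t.

Definition ART_segment P p t : R -> R * R :=
  lerp (envelope_left P p t) (envelope_right P p t).

Definition ART P p : set (R * R) :=
  [set envelope P p t | t in `[0, pi[%classic `\` transition P p] `|`
  \bigcup_(t in transitions P p) (ART_segment P p t @` `[0, 1]%classic).

Definition ART_area P p : R :=
  \sum_(I \in cells P p) arc_area (envelope P p) I.1 I.2 +
  \sum_(t \in transitions P p) arc_area (ART_segment P p t) 0 1.

End CPPOS.

(* Main.v *)
Require Import Defs.
From HB Require Import structures.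
From mathcomp Require Import all_boot all_order all_algebra.
From mathcomp Require Import all_classical all_reals all_analysis.
From mathcomp Require Import ring lra zify.

(** Why the theorem is true.  Fix the interior point [p] and let the line [l] turn
about [p].  It meets the boundary in [x] and [y], on both sides of [p], and both
points move counterclockwise with [l].  The involution shifts the boundary by
half of its sides and so preserves the cyclic order; hence [sigma x] and
[sigma y] also move counterclockwise and the chord joining them turns strictly
counterclockwise ([chord_rotate], which rests on [shift_orient]).  After half a
turn of [l] the two ends are exchanged.  Continuity gives a transformed line
for every normal angle ([line_at_exists]), strict rotation gives only one
([line_at_unique]), and exchanging the ends gives [q (t + pi) = - q t]
([qfunDpi]).

While [x] and [y] stay on two fixed sides, collinearity of [x], [p], [y] is a
quadratic equation for [q t] whose coefficients are trigonometric polynomials.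
On the relevant root the derivative of the quadratic is positive, so [q] is
given by an explicit formula that stays twice differentiable up to the ends of
the cell ([quadratic_root], [quad_rootE]).  The angles for which the sides are
[i] and [j] form a closed set, because the boundary is compact, and, away from
the transitions, also an open one.  So the sides are constant between two
consecutive transitions ([nontransition_cell]); as each vertex accounts for at
most one transition in a period, the cells are the finitely many gaps between
transitions and the two ends of the period ([cellsE]).

With [X = p + q n + q' tau] one has [dX = (q + q'') tau], and integrating
[q q''] by parts turns the area of a cell into half the integral of
[q^2 - q'^2] plus boundary values of [q q' + det2 p (q n + q' tau)].  The
segment inserted at a transition contributes exactly the jump of that
expression, and antiperiodicity closes the period: everything telescopes and
only the integrals are left ([front_area]).

The inequality is Wirtinger's.  By antiperiodicity [q] has a zero [c], and off
[c]
  [q'^2 - q^2 = (q' - q cot (t - c))^2 + (q^2 cot (t - c))'].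
The function [q^2 cot (t - c)] extends continuously by [0] at [c] and takes the
same value at [0] and [pi], so its variations over the cells cancel
([cell_bound], [energy_le0]).  If the area vanishes then [q' = q cot (t - c)] in
each cell, so [q] is a multiple of [sin (t - c)], with one factor for all cells
([energy_eq0]): this is the support function of a point, and the whole front is
that point ([point_ART]).  Conversely a front reduced to a point has constant
arcs and constant segments, whose areas are zero ([ART_area_point]). *)

Import Order.TTheory GRing.Theory Num.Theory.
Import numFieldNormedType.Exports.

Local Open Scope classical_set_scope.
Local Open Scope ring_scope.

Set Implicit Arguments.
Unset Strict Implicit.
Unset Printing Implicit Defensive.

(** * Pointwise continuity *)

Section PointwiseContinuity.
Context {R : realType} {T : topologicalType}.
Implicit Types (f g : T -> R) (w : T).

Lemma continuous_atM f g w : {for w, continuous f} -> {for w, continuous g} ->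
  {for w, continuous (fun x => f x * g x)}.
Proof. by move=> cf cg; apply: cvgM. Qed.

Lemma continuous_atD f g w : {for w, continuous f} -> {for w, continuous g} ->
  {for w, continuous (fun x => f x + g x)}.
Proof. by move=> cf cg; apply: cvgD. Qed.

Lemma continuous_atN f w : {for w, continuous f} ->
  {for w, continuous (fun x => - f x)}.
Proof. by move=> cf; apply: cvgN. Qed.

Lemma continuous_at_cst (c : R) w : {for w, continuous (fun _ : T => c)}.
Proof. exact: cvg_cst. Qed.

End PointwiseContinuity.

Arguments continuous_at_cst {R T} c w.

(** * Plane algebra *)

Ltac coords := rewrite /det2 /dot2 /= /GRing.scale /=.

Section PlaneAlgebra.
Context {R : realType}.
Implicit Types (a b c u v w x y z : R * R) (s t : R).

(** Twice the signed area of the triangle [a b c]. *)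
Definition orient a b c := det2 (b - a) (c - a).

Lemma plane_eq u v : u.1 = v.1 -> u.2 = v.2 -> u = v.
Proof. by case: u v => [u1 u2] [v1 v2] /= -> ->. Qed.

Lemma det2C u v : det2 u v = - det2 v u.
Proof. coords; ring. Qed.

Lemma dot2C u v : dot2 u v = dot2 v u.
Proof. coords; ring. Qed.

Lemma orient_rot a b c : orient a b c = orient b c a.
Proof. rewrite /orient; coords; ring. Qed.

Lemma orient_flip a b c : orient a c b = - orient a b c.
Proof. rewrite /orient; coords; ring. Qed.

(** The factor is the quotient of the coordinates in which [u] does not vanish. *)
Lemma det2_eq0_coll u v : u != 0 -> det2 u v = 0 -> exists s, v = s *: u.
Proof.
case: u v => [u1 u2] [v1 v2] u0; rewrite /det2 /= => /eqP.
rewrite subr_eq0 => /eqP uv.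
have [u10|u10] := eqVneq u1 0.
  have u20 : u2 != 0 by apply: contraNneq u0 => ->; rewrite u10.
  exists (v2 / u2); apply: plane_eq; rewrite /= /GRing.scale /=; last by field.
  rewrite u10 mulr0; apply/eqP; move/eqP: uv; rewrite u10 mul0r eq_sym.
  by rewrite mulf_eq0 (negbTE u20).
exists (v1 / u1); apply: plane_eq; rewrite /= /GRing.scale /=; first by field.
by apply: (mulfI u10); rewrite uv; field.
Qed.

Lemma det2_indep u v w : det2 u v != 0 -> det2 u w = 0 -> det2 v w = 0 -> w = 0.
Proof.
move=> uv uw vw; apply: plane_eq; apply: (mulIf uv); rewrite /= mul0r.
  have -> : w.1 * det2 u v = det2 u w * v.1 - det2 v w * u.1 by coords; ring.
  by rewrite uw vw; ring.
have -> : w.2 * det2 u v = det2 u w * v.2 - det2 v w * u.2 by coords; ring.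
by rewrite uw vw; ring.
Qed.

Lemma dot2_gt0 u : u != 0 -> 0 < dot2 u u.
Proof.
move=> u0; rewrite lt_neqAle /dot2 addr_ge0 ?andbT -?expr2 ?sqr_ge0 //.
rewrite eq_sym paddr_eq0 ?sqr_ge0 // !sqrf_eq0.
by apply: contra u0 => /andP[/eqP a /eqP b]; apply/eqP/plane_eq.
Qed.

Lemma line_through_ends a b : line_through a b a /\ line_through a b b.
Proof. by split; rewrite /line_through /=; coords; ring. Qed.

Lemma line_throughC a b : line_through a b = line_through b a.
Proof.
rewrite /line_through; apply/seteqP; split=> z /= h;
  apply/eqP; rewrite -oppr_eq0; apply/eqP; rewrite -h; coords; ring.
Qed.

Lemma line_throughP a b z : a != b ->
  line_through a b z <-> exists m, z = a + m *: (b - a).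
Proof.
move=> ab; split=> [h|[m ->]]; last by rewrite /line_through /=; coords; ring.
have [|m mE] := @det2_eq0_coll (b - a) (z - a) _ h.
  by rewrite subr_eq0 eq_sym.
by exists m; rewrite -mE addrC subrK.
Qed.

Lemma line_through_eq a b x y : a != b -> x != y ->
  line_through a b x -> line_through a b y -> line_through a b = line_through x y.
Proof.
move=> ab xy /(line_throughP _ ab)[m xE] /(line_throughP _ ab)[k yE].
have km : k - m != 0.
  by rewrite subr_eq0; apply: contra xy => /eqP km; rewrite xE yE km.
have detE z : det2 (y - x) (z - x) = (k - m) * det2 (b - a) (z - a).
  by rewrite xE yE; coords; ring.
apply/seteqP; split=> z; rewrite /line_through /= detE; first by move=> ->; rewrite mulr0.
by move=> /eqP; rewrite mulf_eq0 (negbTE km) => /eqP.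
Qed.

End PlaneAlgebra.

(** * Strict convexity of the polygon *)

Definition side_point {R : realType} (P : nat -> R * R) i (s : R) : R * R :=
  P i + s *: edge P i.

(** Up to the factor [|edge P i|] this is the signed distance of [z] from the
    line of side [i], positive on the inner side; it is affine in [z]. *)
Definition height {R : realType} (P : nat -> R * R) i (z : R * R) : R :=
  det2 (edge P i) (z - P i).

Section Polygon.
Context {R : realType} {n : nat} {P : nat -> R * R} (HP : cppos n P).
Implicit Types (i j k m : nat) (s t r : R) (x y z : R * R).

Local Notation bpt := (side_point P).
Local Notation hgt := (height P).
Local Notation d := n.*2.

Lemma sides_gt3 : (3 < d)%N.
Proof. by have := cppos_gt1 HP; lia. Qed.

Lemma sides_gt0 : (0 < d)%N.
Proof. by have := sides_gt3; lia. Qed.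

Lemma eqmodS i j : i = j %[mod d] -> i.+1 = j.+1 %[mod d].
Proof. by move=> ij; rewrite -(addn1 i) -(addn1 j) -modnDml ij modnDml. Qed.

Lemma eqmodD i j k : i = j %[mod d] -> (i + k = j + k %[mod d])%N.
Proof. by move=> ij; rewrite -modnDml ij modnDml. Qed.

Lemma vertex_per i k : P (i + k * d)%N = P i.
Proof.
elim: k => [|k IH]; first by rewrite mul0n addn0.
by rewrite mulSn addnCA addnC (cppos_periodic HP).
Qed.

Lemma vertex_mod i : P (i %% d)%N = P i.
Proof. by rewrite {2}(divn_eq i d) addnC vertex_per. Qed.

Lemma vertex_eqmod i j : i = j %[mod d] -> P i = P j.
Proof. by move=> ij; rewrite -(vertex_mod i) ij vertex_mod. Qed.

Lemma vertex_inj i j : P i = P j -> i = j %[mod d].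
Proof.
rewrite -(vertex_mod i) -(vertex_mod j).
by apply: (cppos_inj HP); rewrite ltn_mod sides_gt0.
Qed.

Lemma edge_eqmod i j : i = j %[mod d] -> edge P i = edge P j.
Proof. by move=> ij; rewrite /edge (vertex_eqmod ij) (vertex_eqmod (eqmodS ij)). Qed.

Lemma bpt_eqmod i j s : i = j %[mod d] -> bpt i s = bpt j s.
Proof. by move=> ij; rewrite /side_point (edge_eqmod ij) (vertex_eqmod ij). Qed.

Lemma hgt_eqmod i j z : i = j %[mod d] -> hgt i z = hgt j z.
Proof. by move=> ij; rewrite /height (edge_eqmod ij) (vertex_eqmod ij). Qed.

Lemma pred_mod i : exists k, k.+1 = i %[mod d].
Proof.
exists (i + d.-1)%N; rewrite -addnS prednK ?sides_gt0 //.
by rewrite modnDr.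
Qed.

Lemma bpt0 i : bpt i 0 = P i.
Proof. by rewrite /side_point scale0r addr0. Qed.

Lemma bpt1 i : bpt i 1 = P i.+1.
Proof. by rewrite /side_point scale1r /edge addrC subrK. Qed.

Lemma hgt_ends i : hgt i (P i) = 0 /\ hgt i (P i.+1) = 0.
Proof. by split; rewrite /height /edge; coords; ring. Qed.

Lemma hgt_bpt k i s : hgt k (bpt i s) = (1 - s) * hgt k (P i) + s * hgt k (P i.+1).
Proof. by rewrite /height /side_point /edge; coords; ring. Qed.

Lemma hgt_lerp k x y s : hgt k (lerp x y s) = (1 - s) * hgt k x + s * hgt k y.
Proof. by rewrite /height /lerp; coords; ring. Qed.

Lemma hgt_vertex_ge0 i j : 0 <= hgt i (P j).
Proof. exact: (cppos_convex HP). Qed.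

Lemma hgt_bpt_ge0 k i s : 0 <= s <= 1 -> 0 <= hgt k (bpt i s).
Proof.
move=> /andP[s0 s1]; rewrite hgt_bpt addr_ge0 // mulr_ge0 ?hgt_vertex_ge0 //.
by rewrite subr_ge0.
Qed.

Lemma hgt_bpt_self i s : hgt i (bpt i s) = 0.
Proof. by rewrite hgt_bpt !(hgt_ends i).1 (hgt_ends i).2; ring. Qed.

Lemma turn_gt0 i : 0 < det2 (edge P i) (edge P i.+1).
Proof.
rewrite lt_neqAle eq_sym; apply/andP; split; first exact/eqP/(cppos_vertex HP).
have := cppos_convex HP i i.+2; congr (_ <= _).
by rewrite /edge; coords; ring.
Qed.

Lemma edge_neq0 i : edge P i != 0.
Proof.
by apply: contraTneq (turn_gt0 i) => ->; rewrite /det2 /= !mul0r subrr ltxx.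
Qed.

(** The supporting line of side [i] touches the region in that side only: the
    lines of the previous and of the next side bound the parameter by [0] and
    by [1]. *)
Lemma region_line i z : hgt i z = 0 -> (forall k, 0 <= hgt k z) ->
  exists s, 0 <= s <= 1 /\ z = bpt i s.
Proof.
move=> iz zge; have [s sE] := det2_eq0_coll (edge_neq0 i) iz.
have zE : z = bpt i s by rewrite /side_point -sE addrC subrK.
exists s; split=> //; apply/andP; split; last first.
  have := zge i.+1; rewrite zE.
  have -> : hgt i.+1 (bpt i s) = (1 - s) * det2 (edge P i) (edge P i.+1).
    by rewrite /height /side_point /edge; coords; ring.
  by rewrite pmulr_lge0 ?turn_gt0 // subr_ge0.
have [k ki] := pred_mod i.
have := zge k; rewrite zE -(bpt_eqmod _ ki).
have -> : hgt k (bpt k.+1 s) = s * det2 (edge P k) (edge P k.+1).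
  by rewrite /height /side_point /edge; coords; ring.
by rewrite pmulr_lge0 ?turn_gt0.
Qed.

Lemma convex_eq0 (s a b : R) : 0 < s < 1 -> 0 <= a -> 0 <= b ->
  (1 - s) * a + s * b = 0 -> a = 0 /\ b = 0.
Proof.
move=> /andP[s0 s1] a0 b0 /eqP.
have s1' : 0 < 1 - s by rewrite subr_gt0.
rewrite paddr_eq0; [|exact: mulr_ge0 (ltW s1') a0|exact: mulr_ge0 (ltW s0) b0].
by rewrite !mulf_eq0 (gt_eqF s0) (gt_eqF s1') => /andP[/eqP -> /eqP ->].
Qed.

Lemma itv01P s : 0 <= s <= 1 -> [\/ s = 0, s = 1 | 0 < s < 1].
Proof.
move=> /andP[]; rewrite le_eqVlt => /predU1P[<-|s0]; first by constructor 1.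
rewrite le_eqVlt => /predU1P[->|s1]; first by constructor 2.
by constructor 3; apply/andP.
Qed.

(** A vertex on the line of side [i] lies on side [i].  Inside the side it
    would force both ends of the side onto the two lines through the vertex,
    which meet in one point. *)
Lemma vertex_on_line i k : hgt i (P k) = 0 -> k = i %[mod d] \/ k = i.+1 %[mod d].
Proof.
move=> /region_line /(_ (fun j => hgt_vertex_ge0 j k)) [s [/itv01P s01 kE]].
case: s01 => [s0|s1|s01].
- by left; apply: vertex_inj; rewrite kE s0 bpt0.
- by right; apply: vertex_inj; rewrite kE s1 bpt1.
have [j jk] := pred_mod k.
left; symmetry; apply: vertex_inj.
have [hk _] : hgt k (P i) = 0 /\ hgt k (P i.+1) = 0.
  by apply: (convex_eq0 s01); rewrite ?hgt_vertex_ge0 // -hgt_bpt -kE (hgt_ends k).1.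
have [hj _] : hgt j (P i) = 0 /\ hgt j (P i.+1) = 0.
  apply: (convex_eq0 s01); rewrite ?hgt_vertex_ge0 // -hgt_bpt -kE.
  by rewrite -(vertex_eqmod jk) (hgt_ends j).2.
apply/eqP; rewrite -subr_eq0; apply/eqP.
apply: (@det2_indep _ (edge P j) (edge P k)).
- by rewrite -(edge_eqmod jk) gt_eqF ?turn_gt0.
- by rewrite -hj /height -(vertex_eqmod jk) /edge; coords; ring.
- exact: hk.
Qed.

Lemma mod_neq i k : (i < k < i + d)%N -> k <> i %[mod d].
Proof.
move=> ik; have [e eE] : exists e, k = (i + e)%N by exists (k - i)%N; lia.
move/eqP; rewrite eE -[X in _ == X %[mod _]]addn0 eqn_modDl mod0n modn_small; lia.
Qed.

Lemma hgt_vertex_gt0 i k : (i.+1 < k < i + d)%N -> 0 < hgt i (P k).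
Proof.
move=> ik; rewrite lt_neqAle hgt_vertex_ge0 andbT eq_sym.
by apply/eqP => /vertex_on_line [] /mod_neq []; lia.
Qed.

(** Vertices in cyclic order form positively oriented triangles.  Seen from
    [P i], the direction to [P m] turns counterclockwise at each step
    [m -> m.+1].  These directions lie in the half plane to the left of side
    [i], the middle one of three in its interior, which makes the orientation
    transitive. *)
Lemma vertex_orient_gt0 i k m : (i < k < m)%N -> (m < i + d)%N ->
  0 < orient (P i) (P k) (P m).
Proof.
move=> /andP[ik]; elim: m => // m IH km mi.
have adj : (k <= m)%N by lia.
have {}adj : k = m \/ (k < m)%N by lia.
case: adj => [->|{}km].
  have -> : orient (P i) (P m) (P m.+1) = hgt m (P i).
    by rewrite /orient /height /edge; coords; ring.
  rewrite -(vertex_eqmod (modnDr i d)); apply: hgt_vertex_gt0; lia.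
have IH' := IH km (ltnW mi).
have iv : 0 < hgt i (P m) by apply: hgt_vertex_gt0; lia.
(* The three-term relation between the determinants of four vectors. *)
rewrite -(pmulr_rgt0 _ iv).
have -> : hgt i (P m) * orient (P i) (P k) (P m.+1) =
   hgt i (P k) * orient (P m) (P m.+1) (P i) + hgt i (P m.+1) * orient (P i) (P k) (P m).
  rewrite /orient /height /edge; coords; ring.
have -> : orient (P m) (P m.+1) (P i) = hgt m (P i) by [].
have mv : 0 < hgt m (P i).
  rewrite -(vertex_eqmod (modnDr i d)); apply: hgt_vertex_gt0; lia.
have mv' : 0 < hgt i (P m.+1) by apply: hgt_vertex_gt0; lia.
by rewrite ltr_wpDl ?mulr_gt0 // mulr_ge0 ?hgt_vertex_ge0 // ltW.
Qed.

Lemma vertex_orient_ge0 i k m : (i <= k <= m)%N -> (m <= i + d)%N ->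
  0 <= orient (P i) (P k) (P m).
Proof.
move=> /andP[ik km] mi.
have [->|ik'] := eqVneq i k; first by rewrite /orient; coords; lra.
have [->|km'] := eqVneq k m; first by rewrite /orient; coords; lra.
have [->|mi'] := eqVneq m (i + d)%N.
  by rewrite (vertex_eqmod (modnDr i d)) /orient; coords; lra.
by apply/ltW/vertex_orient_gt0; lia.
Qed.

(** The orientation is affine in each of its three arguments, so it is a convex
    combination of orientations of vertices. *)
Lemma side_orient_ge0 i j k s r t : (i < j < k)%N -> (k < i + d)%N ->
  0 <= s <= 1 -> 0 <= r <= 1 -> 0 <= t <= 1 ->
  0 <= orient (bpt i s) (bpt j r) (bpt k t).
Proof.
move=> ijk ki /andP[s0 s1] /andP[r0 r1] /andP[t0 t1].
have aff a b c e : orient (bpt a e) b c =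
    (1 - e) * orient (P a) b c + e * orient (P a.+1) b c.
  by rewrite /orient /side_point /edge; coords; ring.
have mix e a b : 0 <= e -> e <= 1 -> 0 <= a -> 0 <= b -> 0 <= (1 - e) * a + e * b :> R.
  by move=> e0 e1 a0 b0; rewrite addr_ge0 // mulr_ge0 // subr_ge0.
have step a b c e : 0 <= e -> e <= 1 -> 0 <= orient (P a) b c ->
    0 <= orient (P a.+1) b c -> 0 <= orient (bpt a e) b c.
  by move=> e0 e1 h1 h2; rewrite aff // mix.
apply: (step) => //; rewrite orient_rot; apply: (step) => //; rewrite orient_rot;
  apply: (step) => //; rewrite orient_rot; apply: vertex_orient_ge0; lia.
Qed.

End Polygon.

(** * The boundary involution preserves orientation *)

Section Chords.
Context {R : realType} {n : nat} {P : nat -> R * R} (HP : cppos n P).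
Implicit Types (i j k m : nat) (s t r : R) (x y z : R * R).

Local Notation d := n.*2.
Local Notation bpt := (side_point P).
Local Notation hgt := (height P).

(** Weak agreement of signs: a zero agrees with every sign. *)
Definition same_sign (a b : R) := (0 <= a /\ 0 <= b) \/ (a <= 0 /\ b <= 0).

Lemma orient_side i s r z : orient (bpt i s) (bpt i r) z = (r - s) * hgt i z.
Proof. by rewrite /orient /height /side_point /edge; coords; ring. Qed.

Lemma same_sign_mul (e a b : R) : 0 <= a -> 0 <= b -> same_sign (e * a) (e * b).
Proof.
move=> a0 b0; have [e0|e0] := leP 0 e; [left|right].
  by rewrite !mulr_ge0.
by rewrite !mulr_le0_ge0 // ltW.
Qed.

Lemma shift_orient_ge0 i j k s r t : (i < j < k)%N -> (k < i + d)%N ->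
  0 <= s <= 1 -> 0 <= r <= 1 -> 0 <= t <= 1 ->
  0 <= orient (bpt i s) (bpt j r) (bpt k t) /\
  0 <= orient (bpt (i + n) s) (bpt (j + n) r) (bpt (k + n) t).
Proof.
move=> ijk ki; have ijk' : (i + n < j + n < k + n)%N by rewrite !ltn_add2r.
have ki' : (k + n < i + n + d)%N by rewrite addnAC ltn_add2r.
by move=> s01 r01 t01; split; exact: (side_orient_ge0 HP).
Qed.

Lemma shift_orient_le0 i j k s r t : (i < k < j)%N -> (j < i + d)%N ->
  0 <= s <= 1 -> 0 <= r <= 1 -> 0 <= t <= 1 ->
  orient (bpt i s) (bpt j r) (bpt k t) <= 0 /\
  orient (bpt (i + n) s) (bpt (j + n) r) (bpt (k + n) t) <= 0.
Proof.
move=> ikj ji s01 r01 t01; rewrite !(orient_flip _ (bpt _ t)) !oppr_le0.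
exact: shift_orient_ge0.
Qed.

(** The involution moves the indices of the three sides by [n], which does not
    change their cyclic order; two points of the same side keep their order on
    it. *)
Lemma shift_orient i j k s r t : 0 <= s <= 1 -> 0 <= r <= 1 -> 0 <= t <= 1 ->
  same_sign (orient (bpt i s) (bpt j r) (bpt k t))
    (orient (bpt (i + n) s) (bpt (j + n) r) (bpt (k + n) t)).
Proof.
move=> s01 r01 t01.
wlog : i j k / [/\ (i < d)%N, (j < d)%N & (k < d)%N].
  move=> W; have mm a : a = a %% d %[mod d] by rewrite modn_mod.
  have mn a : (a + n = a %% d + n %[mod d])%N by rewrite modnDml.
  rewrite (bpt_eqmod HP s (mm i)) (bpt_eqmod HP r (mm j)) (bpt_eqmod HP t (mm k)).
  rewrite (bpt_eqmod HP s (mn i)) (bpt_eqmod HP r (mn j)) (bpt_eqmod HP t (mn k)).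
  by apply: W; rewrite !ltn_mod !(sides_gt0 HP).
move=> [id jd kd].
have [<-|ij] := eqVneq i j.
  by rewrite !orient_side; apply: same_sign_mul; exact: (hgt_bpt_ge0 HP).
have [<-|jk] := eqVneq j k.
  rewrite !(orient_rot (bpt _ s)) !orient_side.
  by apply: same_sign_mul; exact: (hgt_bpt_ge0 HP).
have [<-|ik] := eqVneq i k.
  rewrite -!(orient_rot (bpt _ t)) !orient_side.
  by apply: same_sign_mul; exact: (hgt_bpt_ge0 HP).
have [ltij|leji] := ltnP i j.
  have [ltjk|lekj] := ltnP j k; first by left; apply: shift_orient_ge0 => //; lia.
  have [ltik|leki] := ltnP i k; first by right; apply: shift_orient_le0 => //; lia.
  by left; rewrite -!(orient_rot (bpt _ t)); apply: shift_orient_ge0 => //; lia.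
have [ltik|leki] := ltnP i k.
  by right; rewrite !(orient_rot (bpt _ s)); apply: shift_orient_le0 => //; lia.
have [ltjk|lekj] := ltnP j k.
  by left; rewrite !(orient_rot (bpt _ s)); apply: shift_orient_ge0 => //; lia.
by right; rewrite -!(orient_rot (bpt _ t)); apply: shift_orient_le0 => //; lia.
Qed.

Lemma bpt_inj i s r : bpt i s = bpt i r -> s = r.
Proof.
move=> /addrI /eqP; rewrite -subr_eq0 -scalerBl scaler_eq0.
by rewrite (negbTE (edge_neq0 HP i)) orbF subr_eq0 => /eqP.
Qed.

Lemma vertex_bpt k j r : P k = bpt j r ->
  (k = j %[mod d] /\ r = 0) \/ (k = j.+1 %[mod d] /\ r = 1).
Proof.
move=> kE; have /(vertex_on_line HP)[kj|kj] : hgt j (P k) = 0.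
- by rewrite kE hgt_bpt_self.
- left; split=> //; apply: (@bpt_inj j).
  by rewrite -kE (vertex_eqmod HP kj) bpt0.
right; split=> //; apply: (@bpt_inj j).
by rewrite -kE (vertex_eqmod HP kj) bpt1.
Qed.

Lemma eqmodSS_neq i : i.+2 <> i %[mod d].
Proof. by apply: (mod_neq); have := sides_gt3 HP; lia. Qed.

Lemma edge_on_line i j : hgt j (P i) = 0 -> hgt j (P i.+1) = 0 -> i = j %[mod d].
Proof.
move=> h1 h2; have [//|ij] := vertex_on_line HP h1.
have [ij'|ij'] := vertex_on_line HP h2.
  by have := eqmodS ij'; rewrite -ij => /eqmodSS_neq.
by have /mod_neq[] := etrans ij' (esym ij); have := sides_gt3 HP; lia.
Qed.

(** At a vertex the two incident sides prescribe the same image, so that the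
    involution is well defined. *)
Lemma shift_wd i j s r : 0 <= s <= 1 -> 0 <= r <= 1 -> bpt i s = bpt j r ->
  bpt (i + n) s = bpt (j + n) r.
Proof.
move=> s01 r01 E.
have vert k : P k = bpt j r -> P (k + n)%N = bpt (j + n) r.
  move=> /vertex_bpt [] [kj ->].
    by rewrite bpt0; apply: (vertex_eqmod HP); apply: eqmodD.
  by rewrite bpt1 -addSn; apply: (vertex_eqmod HP); apply: eqmodD.
have [s0|s1|si] := itv01P s01.
- by rewrite s0 bpt0; apply: vert; rewrite -E s0 bpt0.
- by rewrite s1 bpt1 -addSn; apply: vert; rewrite -E s1 bpt1.
have [h1 h2] : hgt j (P i) = 0 /\ hgt j (P i.+1) = 0.
  by apply: (convex_eq0 si); rewrite ?(hgt_vertex_ge0 HP) // -hgt_bpt E hgt_bpt_self.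
have ij := edge_on_line h1 h2.
have sr : s = r by apply: (@bpt_inj i); rewrite E; apply: (bpt_eqmod HP).
by rewrite sr; apply: (bpt_eqmod HP) => //; apply: eqmodD.
Qed.

Lemma shiftK i s : bpt (i + n + n) s = bpt i s.
Proof. by apply: (bpt_eqmod HP); rewrite -addnA addnn modnDr. Qed.

(** The shift is an involution. *)
Lemma shift_inj i j s r : 0 <= s <= 1 -> 0 <= r <= 1 ->
  bpt (i + n) s = bpt (j + n) r -> bpt i s = bpt j r.
Proof. by move=> s01 r01 /(shift_wd s01 r01); rewrite !shiftK. Qed.

(** Heights of boundary points are nonnegative, so a positive sum says that
    [x] and [y] lie on no common side: their chord enters the interior. *)
Definition transverse x y := forall k, 0 < hgt k x + hgt k y.

Lemma transverse_shift i j s r : 0 <= s <= 1 -> 0 <= r <= 1 ->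
  transverse (bpt i s) (bpt j r) -> transverse (bpt (i + n) s) (bpt (j + n) r).
Proof.
move=> s01 r01 tr k; rewrite lt_neqAle addr_ge0 ?(hgt_bpt_ge0 HP) // andbT eq_sym.
rewrite paddr_eq0 ?(hgt_bpt_ge0 HP) //; apply/negP => /andP[/eqP hX /eqP hY].
have back a e : 0 <= e <= 1 -> hgt k (bpt (a + n) e) = 0 -> hgt (k + n) (bpt a e) = 0.
  move=> e01 /(region_line HP) /(_ (fun m => hgt_bpt_ge0 HP m _ e01)) [e' [e'01 E]].
  by have := shift_wd e01 e'01 E; rewrite shiftK => ->; rewrite hgt_bpt_self.
by have := tr (k + n)%N; rewrite !back // addr0 ltxx.
Qed.

Lemma transverseC x y : transverse x y -> transverse y x.
Proof. by move=> tr k; rewrite addrC. Qed.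

Lemma transverse_neq i s y : transverse (bpt i s) y -> bpt i s != y.
Proof.
by move=> tr; apply: contraTneq (tr i) => <-; rewrite hgt_bpt_self addr0 ltxx.
Qed.

Lemma transverse_gt0 i s y : transverse (bpt i s) y -> 0 < hgt i y.
Proof. by move=> /(_ i); rewrite hgt_bpt_self add0r. Qed.

(** A boundary point inside the segment would put its two ends on a common
    side.  A point outside the segment would be on the outer side of a
    supporting line through one of the ends. *)
Lemma line_boundary i j k s r t : 0 <= s <= 1 -> 0 <= r <= 1 -> 0 <= t <= 1 ->
  transverse (bpt i s) (bpt j r) -> line_through (bpt i s) (bpt j r) (bpt k t) ->
  bpt k t = bpt i s \/ bpt k t = bpt j r.
Proof.
move=> s01 r01 t01 tr /(line_throughP _ (transverse_neq tr)) [m zE].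
have {}zE : bpt k t = lerp (bpt i s) (bpt j r) m by [].
have iy := transverse_gt0 tr; have jx := transverse_gt0 (transverseC tr).
have m0 : 0 <= m.
  have := hgt_bpt_ge0 HP i k t01; rewrite zE hgt_lerp hgt_bpt_self mulr0 add0r.
  by rewrite pmulr_lge0.
have m1 : m <= 1.
  have := hgt_bpt_ge0 HP j k t01; rewrite zE hgt_lerp hgt_bpt_self mulr0 addr0.
  by rewrite pmulr_lge0 // subr_ge0.
have m01 : 0 <= m <= 1 by rewrite m0.
have [m00|m11|mi] := itv01P m01.
- by left; rewrite zE m00 /lerp scale0r addr0.
- by right; rewrite zE m11 /lerp scale1r addrC subrK.
have [h1 h2] : hgt k (bpt i s) = 0 /\ hgt k (bpt j r) = 0.
  by apply: (convex_eq0 mi); rewrite ?(hgt_bpt_ge0 HP) // -hgt_lerp -zE hgt_bpt_self.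
by have := tr k; rewrite h1 h2 addr0 ltxx.
Qed.

(** * Chords through an interior point *)

Section Interior.
Context {p : R * R} (hp : forall k, 0 < hgt k p).

(** The points on the sides [i] and [j] are aligned with [p], on opposite sides
    of it; the conditions are polynomial, hence closed. *)
Record chord i j s r : Prop := Chord {
  chord_s : 0 <= s <= 1;
  chord_r : 0 <= r <= 1;
  chord_det : det2 (bpt i s - p) (bpt j r - p) = 0;
  chord_dot : dot2 (bpt i s - p) (bpt j r - p) <= 0 }.

Lemma chordC i j s r : chord i j s r -> chord j i r s.
Proof.
case=> s01 r01 de dt; split=> //.
  by rewrite det2C de oppr0.
by rewrite dot2C.
Qed.

Lemma chord_lerp i j s r : chord i j s r ->
  exists l, 0 < l < 1 /\ p = lerp (bpt i s) (bpt j r) l.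
Proof.
case=> s01 r01 de dt.
have neq k e : bpt k e - p != 0.
  rewrite subr_eq0; apply: contraTneq (hp k) => <-.
  by rewrite hgt_bpt_self ltxx.
have [m mE] := det2_eq0_coll (neq i s) de.
have m0 : m < 0.
  rewrite lt_neqAle; apply/andP; split.
    by apply: contraNneq (neq j r); rewrite mE => ->; rewrite scale0r.
  rewrite -(pmulr_lle0 _ (dot2_gt0 (neq i s))); apply: le_trans dt.
  by rewrite mE; coords; lra.
have m1 : 0 < 1 - m by lra.
(* From y - p = m (x - p) follows p = x + (1 - m)^-1 (y - x). *)
exists (1 - m)^-1; split.
  by rewrite invr_gt0 m1 invf_lt1 //; lra.
have yE : bpt j r = p + m *: (bpt i s - p) by rewrite -mE addrC subrK.
have m1' : 1 - m != 0 by rewrite gt_eqF.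
by rewrite /lerp yE; apply: plane_eq; rewrite /= /GRing.scale /=; field.
Qed.

Lemma chord_transverse i j s r : chord i j s r -> transverse (bpt i s) (bpt j r).
Proof.
move=> c k; have [l [/andP[l0 l1] pE]] := chord_lerp c.
apply: lt_le_trans (hp k) _; rewrite pE hgt_lerp.
have hx := hgt_bpt_ge0 HP k i (chord_s c); have hy := hgt_bpt_ge0 HP k j (chord_r c).
by rewrite lerD // ler_piMl // ltW // gtrBl.
Qed.

Lemma chord_transverse_shift i j s r :
  chord i j s r -> transverse (bpt (i + n) s) (bpt (j + n) r).
Proof.
by move=> c; apply: transverse_shift (chord_s c) (chord_r c) (chord_transverse c).
Qed.

(** The points [x'] and [y'] of the second chord lie strictly on the two sides
    of the first one.  Since the involution weakly preserves orientations,
    their images lie weakly on the two sides of the transformed chord, and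
    strictly because a line meets the boundary in two points only. *)
Lemma chord_rotate i j s r i' j' s' r' : chord i j s r -> chord i' j' s' r' ->
  0 < det2 (bpt i s - bpt j r) (bpt i' s' - bpt j' r') ->
  0 < det2 (bpt (i + n) s - bpt (j + n) r) (bpt (i' + n) s' - bpt (j' + n) r').
Proof.
move=> c c' w; have [l [/andP[l0 l1] pE]] := chord_lerp c.
have [l' [/andP[l'0 l'1] pE']] := chord_lerp c'.
have ox : 0 < orient (bpt j r) (bpt i s) (bpt i' s').
  have -> : orient (bpt j r) (bpt i s) (bpt i' s') =
     det2 (bpt i s - bpt j r) (bpt i' s' - p)
       + (1 - l) * det2 (bpt i s - bpt j r) (bpt i s - bpt j r).
    by rewrite pE /lerp /orient; coords; ring.
  have -> : bpt i' s' - p = l' *: (bpt i' s' - bpt j' r').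
    by rewrite pE' /lerp; apply: plane_eq; rewrite /= /GRing.scale /=; ring.
  have -> : forall (u v : R * R) (a b : R), det2 u (a *: v) + b * det2 u u = a * det2 u v.
    by move=> *; coords; ring.
  by rewrite mulr_gt0.
have oy : orient (bpt j r) (bpt i s) (bpt j' r') < 0.
  have -> : orient (bpt j r) (bpt i s) (bpt j' r') =
     det2 (bpt i s - bpt j r) (bpt j' r' - p)
       + (1 - l) * det2 (bpt i s - bpt j r) (bpt i s - bpt j r).
    by rewrite pE /lerp /orient; coords; ring.
  have -> : bpt j' r' - p = (l' - 1) *: (bpt i' s' - bpt j' r').
    by rewrite pE' /lerp; apply: plane_eq; rewrite /= /GRing.scale /=; ring.
  have -> : forall (u v : R * R) (a b : R), det2 u (a *: v) + b * det2 u u = a * det2 u v.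
    by move=> *; coords; ring.
  by rewrite nmulr_rlt0 // subr_lt0.
have [[_ oX]|[+ _]] := shift_orient j i i' (chord_r c) (chord_s c) (chord_s c');
  last by rewrite leNgt ox.
have [[+ _]|[_ oY]] := shift_orient j i j' (chord_r c) (chord_s c) (chord_r c').
  by rewrite leNgt oy.
have E : det2 (bpt (i + n) s - bpt (j + n) r) (bpt (i' + n) s' - bpt (j' + n) r') =
  orient (bpt (j + n) r) (bpt (i + n) s) (bpt (i' + n) s') -
  orient (bpt (j + n) r) (bpt (i + n) s) (bpt (j' + n) r').
  by rewrite /orient; coords; ring.
rewrite lt_neqAle E; apply/andP; split; last by lra.
apply/negP => /eqP W0.
have X0 : orient (bpt (j + n) r) (bpt (i + n) s) (bpt (i' + n) s') = 0 by lra.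
have [|X|X] := line_boundary (chord_r c) (chord_s c) (chord_s c')
   (transverseC (chord_transverse_shift c)) (k := (i' + n)%N) .
- exact: X0.
- by move: ox; rewrite (shift_inj _ _ X) ?(chord_s c') ?(chord_r c) // /orient subrr;
    coords; rewrite !mulr0 subrr ltxx.
by move: ox; rewrite (shift_inj _ _ X) ?(chord_s c') ?(chord_s c) // /orient;
  coords; lra.
Qed.

Lemma chord_line_mem i j s r i' j' s' r' : chord i j s r -> chord i' j' s' r' ->
  det2 (bpt i s - bpt j r) (bpt i' s' - bpt j' r') = 0 ->
  line_through (bpt i s) (bpt j r) (bpt i' s').
Proof.
move=> c c' w; have [l [_ pE]] := chord_lerp c.
have [l' [_ pE']] := chord_lerp c'.
rewrite /line_through /=.
have -> : det2 (bpt j r - bpt i s) (bpt i' s' - bpt i s) =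
     - det2 (bpt i s - bpt j r) (bpt i' s' - p)
       + l * det2 (bpt i s - bpt j r) (bpt i s - bpt j r).
  by rewrite pE /lerp; coords; ring.
have -> : bpt i' s' - p = l' *: (bpt i' s' - bpt j' r').
  by rewrite pE' /lerp; apply: plane_eq; rewrite /= /GRing.scale /=; ring.
have -> : forall (u v : R * R) (a b : R), - det2 u (a *: v) + b * det2 u u = - a * det2 u v.
  by move=> *; coords; ring.
by rewrite w mulr0.
Qed.

Lemma chord_same_line i j s r i' j' s' r' : chord i j s r -> chord i' j' s' r' ->
  det2 (bpt i s - bpt j r) (bpt i' s' - bpt j' r') = 0 ->
  (bpt i' s' = bpt i s /\ bpt j' r' = bpt j r) \/
  (bpt i' s' = bpt j r /\ bpt j' r' = bpt i s).
Proof.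
move=> c c' w; have xm := chord_line_mem c c' w.
have ym : line_through (bpt i s) (bpt j r) (bpt j' r').
  apply: chord_line_mem c (chordC c') _; rewrite -[RHS]oppr0 -w; coords; ring.
have ne := transverse_neq (chord_transverse c').
have t := chord_transverse c.
have [xE|xE] := line_boundary (chord_s c) (chord_r c) (chord_s c') t xm;
have [yE|yE] := line_boundary (chord_s c) (chord_r c) (chord_r c') t ym.
- by move: ne; rewrite xE yE eqxx.
- by left.
- by right.
by move: ne; rewrite xE yE eqxx.
Qed.

(** If the chords were not on one line, [chord_rotate], applied in one order or
    in the other, would make the transformed directions independent. *)
Lemma chord_unique i j s r i' j' s' r' : chord i j s r -> chord i' j' s' r' ->
  det2 (bpt (i + n) s - bpt (j + n) r) (bpt (i' + n) s' - bpt (j' + n) r') = 0 ->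
  (bpt i' s' = bpt i s /\ bpt j' r' = bpt j r) \/
  (bpt i' s' = bpt j r /\ bpt j' r' = bpt i s).
Proof.
move=> c c' W; apply: chord_same_line => //.
apply/eqP; rewrite eq_le !leNgt; apply/andP; split; apply/negP.
  by move/(chord_rotate c c'); rewrite W ltxx.
move=> h; have := chord_rotate c' c; rewrite det2C oppr_gt0 => /(_ h).
by rewrite det2C W oppr0 ltxx.
Qed.

(** Otherwise the sequence [det2 (P k) u] would be nondecreasing and periodic,
    hence constant, and all edges would be parallel to [u]. *)
Lemma edge_turns_back (u : R * R) : u != 0 -> exists k, det2 (edge P k) u < 0.
Proof.
move=> u0; apply: contrapT => /forallNP nk.
have mono k : det2 (P k) u <= det2 (P k.+1) u.
  have : 0 <= det2 (edge P k) u by rewrite leNgt; apply/negP/nk.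
  by rewrite /edge; coords; lra.
have mono' := homo_leq (@lexx _ R) (@le_trans _ R) mono.
have cst k : det2 (edge P k) u = 0.
  have h1 := mono k; have h2 : det2 (P k.+1) u <= det2 (P (k + d)%N) u.
    by apply: mono'; have := sides_gt3 HP; lia.
  rewrite (vertex_eqmod HP (modnDr k d)) in h2.
  by move: h1 h2; rewrite /edge; coords; lra.
have e01 : det2 (edge P 0) (edge P 1) != 0 by rewrite gt_eqF ?(turn_gt0 HP).
by move: u0; rewrite (det2_indep e01 (cst 0) (cst 1)) eqxx.
Qed.

(** The ray leaves the polygon through the first side line that it meets: the
    one for which [- det2 (edge P i) u / height P i p] is largest. *)
Lemma ray_exit (u : R * R) : u != 0 ->
  exists i s e, [/\ 0 <= s <= 1, 0 < e & bpt i s = p + e *: u].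
Proof.
move=> u0; have [k0 k0u] := edge_turns_back u0.
pose g k := det2 (edge P k) u.
pose F (k : 'I_d) := - g k / hgt k p.
have [d' dE] : exists d', d = d'.+1 by exists d.-1; rewrite prednK ?(sides_gt0 HP).
have i0 : 'I_d by rewrite dE; exact: ord0.
have [im _ imax] := @arg_maxP _ R _ i0 predT F isT.
pose m := F im.
have max k : - g k <= m * hgt k p.
  have kd : (k %% d < d)%N by rewrite ltn_mod (sides_gt0 HP).
  have := imax (Ordinal kd) isT; rewrite /F /= -/(F im) -/m.
  have km : k %% d = k %[mod d] by rewrite modn_mod.
  rewrite (hgt_eqmod HP _ km) /g (edge_eqmod HP km).
  by rewrite ler_pdivrMr ?hp.
have m0 : 0 < m.
  have := max k0; have := hp k0; move: k0u; rewrite -/(g k0) => a b c.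
  by rewrite -(pmulr_lgt0 _ b); apply: lt_le_trans c; rewrite oppr_gt0.
have hE k e : hgt k (p + e *: u) = hgt k p + e * g k.
  by rewrite /height /g; coords; ring.
have iE : hgt im (p + m^-1 *: u) = 0.
  have gi : - g im = m * hgt im p by rewrite /m /F divfK // gt_eqF.
  by rewrite hE -[g im]opprK gi mulrN mulrA mulVf ?gt_eqF // mul1r subrr.
have [|s [s01 sE]] := region_line HP iE.
  move=> k; rewrite hE; have := max k => h.
  rewrite -(pmulr_rge0 _ m0) mulrDr mulrA divff ?gt_eqF // mul1r; lra.
by exists im, s, m^-1; split; rewrite ?invr_gt0.
Qed.

End Interior.
End Chords.

(** * Closed sets of angles *)

Section ProjectionClosed.
Context {R : realType}.
Notation T := (R * (R * R))%type.

(** Projection along a compact set is a closed map. *)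
Lemma closed_projection (C : set T) : closed C ->
  closed [set t | exists s r, [/\ 0 <= s <= 1, 0 <= r <= 1 & C (t, (s, r))]].
Proof.
move=> cC t0 ct0.
pose K : set T := `[t0 - 1, t0 + 1]%classic `*` (`[0, 1]%classic `*` `[0, 1]%classic).
have cK : compact (K `&` C).
  apply: compact_closedI => //; apply: compact_setX; first exact: segment_compact.
  by apply: compact_setX; exact: segment_compact.
have cI : compact (fst @` (K `&` C)).
  apply: continuous_compact cK; apply: continuous_subspaceT => w; exact: cvg_fst.
have clI := compact_closed (@Rhausdorff R) cI.
have : closure (fst @` (K `&` C)) t0.
  move=> B nB; have nb : nbhs t0 (B `&` ball t0 1).
    by apply: filterI => //; apply: nbhsx_ballx.
  have [t [[s [r [s01 r01 Ct]]] [Bt bt]]] := ct0 _ nb.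
  exists t; split=> //; exists (t, (s, r)) => //; split=> //.
  rewrite /K /=; move: bt; rewrite /ball /= ltr_distlC !in_itv /= => /andP[h1 h2].
  by split=> //; rewrite !ltW.
move=> /clI [[t [s r]] [[_ [/= h1 h2]] Ct] /= tE]; rewrite -tE.
by exists s, r; split; rewrite ?in_itv //; move: h1 h2; rewrite /= !in_itv.
Qed.

Definition plane_continuous (f : T -> R * R) :=
  continuous (fun w => (f w).1) /\ continuous (fun w => (f w).2).

Lemma plane_continuous_cst (a : R * R) : plane_continuous (fun _ => a).
Proof. by split=> w; exact: continuous_at_cst. Qed.

Lemma plane_continuousB f g : plane_continuous f -> plane_continuous g ->
  plane_continuous (fun w => f w - g w).
Proof.
move=> [f1 f2] [g1 g2]; split=> w.
  exact: (continuous_atD (f1 w) (continuous_atN (g1 w))).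
exact: (continuous_atD (f2 w) (continuous_atN (g2 w))).
Qed.

Lemma plane_continuous_line (a v : R * R) (u : T -> R) : continuous u ->
  plane_continuous (fun w => a + u w *: v).
Proof.
move=> cu; have affine (c e : R) : continuous (fun w => c + u w * e).
  move=> w.
  exact: (continuous_atD (continuous_at_cst c w)
    (continuous_atM (cu w) (continuous_at_cst e w))).
by split; exact: affine.
Qed.

Lemma continuous_dot2 f g : plane_continuous f -> plane_continuous g ->
  continuous (fun w => dot2 (f w) (g w)).
Proof.
move=> [f1 f2] [g1 g2] w.
exact: (continuous_atD (continuous_atM (f1 w) (g1 w)) (continuous_atM (f2 w) (g2 w))).
Qed.

Lemma continuous_det2 f g : plane_continuous f -> plane_continuous g ->
  continuous (fun w => det2 (f w) (g w)).
Proof.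
move=> [f1 f2] [g1 g2] w.
exact: (continuous_atD (continuous_atM (f1 w) (g2 w))
  (continuous_atN (continuous_atM (f2 w) (g1 w)))).
Qed.

Lemma plane_continuous_nvec : plane_continuous (fun w => nvec w.1).
Proof.
split=> w; apply: (@continuous_comp _ _ _ fst _); try exact: cvg_fst.
  exact: continuous_cos.
exact: continuous_sin.
Qed.

Lemma plane_continuous_tvec : plane_continuous (fun w => tvec w.1).
Proof.
have [cc cs] := plane_continuous_nvec; split=> w; last exact: cc.
exact: (continuous_atN (cs w)).
Qed.

Lemma continuous_param1 : continuous (fun w : T => w.2.1).
Proof.
move=> w; apply: (@continuous_comp _ _ _ (fun w : T => w.2) fst); first exact: cvg_snd.
exact: cvg_fst.
Qed.

Lemma continuous_param2 : continuous (fun w : T => w.2.2).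
Proof.
move=> w; apply: (@continuous_comp _ _ _ (fun w : T => w.2) snd); first exact: cvg_snd.
exact: cvg_snd.
Qed.

Lemma closed_eq0 (f : T -> R) : continuous f -> closed [set w | f w = 0].
Proof.
move=> cf; have := @closed_comp _ _ f [set x | x = 0].
by apply; [move=> w _; exact: cf|exact: closed_eq].
Qed.

Lemma closed_ge0 (f : T -> R) : continuous f -> closed [set w | 0 <= f w].
Proof.
move=> cf; have := @closed_comp _ _ f [set x | 0 <= x].
by apply; [move=> w _; exact: cf|exact: closed_ge].
Qed.

Lemma closed_and (A B : T -> Prop) : closed [set w | A w] -> closed [set w | B w] ->
  closed [set w | A w /\ B w].
Proof. by move=> cA cB; apply: closedI. Qed.

(** A finite union of closed sets. *)
Lemma closed_exists_ord (A : nat -> R -> Prop) m :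
  (forall i, closed [set t | A i t]) -> closed [set t | exists i, (i < m)%N /\ A i t].
Proof.
move=> cA; have -> : [set t | exists i, (i < m)%N /\ A i t] =
  \bigcup_(i in `I_m) [set t | A i t].
  by apply/seteqP; split=> t [i]; [case|]; exists i.
by apply: closed_bigcup => //; exact: finite_II.
Qed.

(** A connected segment covered by two closed sets meets both; the last two
    hypotheses exclude that it lies in one of them. *)
Lemma segment_meet (a b : R) (A B : set R) : a <= b -> closed A -> closed B ->
  (forall t, a <= t <= b -> A t \/ B t) -> (A a -> B b) -> (B a -> A b) ->
  exists t, [/\ a <= t <= b, A t & B t].
Proof.
move=> ab cA cB cov aAB aBA; apply: contrapT => nex.
have dis t : a <= t <= b -> A t -> ~ B t.
  by move=> tab At Bt; apply: nex; exists t.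
have ain : `[a, b]%classic a by rewrite /= in_itv /= lexx.
have bin : `[a, b]%classic b by rewrite /= in_itv /= lexx ab.
have E : `[a, b]%classic `&` A !=set0 -> `[a, b]%classic `&` A = `[a, b]%classic.
  move=> ne; apply: (@segment_connected R a b) => //.
    exists (~` B); first exact: closed_openC.
    apply/seteqP; split=> t [tab] /=.
      by move=> At; split=> //; apply: dis At; move: tab; rewrite /= in_itv.
    by move=> nB; split=> //; have [] := cov t _ => //; move: tab; rewrite /= in_itv.
  by exists A.
have aab : a <= a <= b by rewrite lexx.
have bab : a <= b <= b by rewrite lexx ab.
have [Aa|Ba] := cov a aab.
  have : (`[a, b]%classic `&` A) b by rewrite E //; exists a.
  by move=> [_ Ab]; apply: (dis b bab Ab); exact: aAB.
have : (`[a, b]%classic `&` A) a by rewrite E //; exists b; split=> //; exact: aBA.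
by move=> [_ Aa]; apply: (dis a).
Qed.

End ProjectionClosed.

(** * A transformed line for every normal direction *)

Section Existence.
Context {R : realType} {n : nat} {P : nat -> R * R} (HP : cppos n P).
Context {p : R * R} (hp : forall k, 0 < height P k p).
Implicit Types (i j k m : nat) (s t r : R) (x y z : R * R).
Local Notation d := n.*2.
Local Notation bpt := (side_point P).
Local Notation chord := (@chord R P p).

Lemma nvec_neq0 t : nvec t != 0.
Proof.
apply/negP => /eqP [c0 s0]; have := cos2Dsin2 t.
by rewrite c0 s0 expr0n /= addr0 => /eqP; rewrite eq_sym oner_eq0.
Qed.

Lemma side_point_continuous i (u : R * (R * R) -> R) : continuous u ->
  plane_continuous (fun w => bpt i (u w)).
Proof. exact: plane_continuous_line. Qed.

(** The vectors [nvec t] and [tvec t] form an orthonormal basis. *)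
Lemma frame_decomp t z : z = dot2 (nvec t) z *: nvec t + dot2 (tvec t) z *: tvec t.
Proof.
have := cos2Dsin2 t; rewrite !expr2 => cs.
apply: plane_eq; rewrite /nvec /tvec; coords.
  have : z.1 = z.1 * (cos t * cos t + sin t * sin t) by rewrite cs mulr1.
  by move=> {1}->; ring.
have : z.2 = z.2 * (cos t * cos t + sin t * sin t) by rewrite cs mulr1.
by move=> {1}->; ring.
Qed.

(** The ray from [p] of angle [ph] ends in [x] and the opposite ray in [y];
    [e = 1] and [e = - 1] select a sign for the product of the transformed
    direction with [nvec th], and [e = 0] leaves it free. *)
Definition ray_chord (e : R) th ph i j s r :=
  det2 (nvec ph) (bpt i s - p) = 0 /\ (0 <= dot2 (nvec ph) (bpt i s - p) /\
  (det2 (nvec ph) (bpt j r - p) = 0 /\ (0 <= - dot2 (nvec ph) (bpt j r - p) /\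
  0 <= e * dot2 (nvec th) (bpt (i + n) s - bpt (j + n) r)))).

Definition ray_set (e th : R) : set R := [set ph | exists i, (i < d)%N /\
  exists j, (j < d)%N /\ exists s r, [/\ 0 <= s <= 1, 0 <= r <= 1 &
   ray_chord e th ph i j s r]].

Lemma ray_set_closed e th : closed (ray_set e th).
Proof.
apply: closed_exists_ord => i; apply: closed_exists_ord => j.
apply: (@closed_projection _ [set w | ray_chord e th w.1 i j w.2.1 w.2.2]).
have cx := plane_continuousB (side_point_continuous i continuous_param1)
  (plane_continuous_cst p).
have cy := plane_continuousB (side_point_continuous j continuous_param2)
  (plane_continuous_cst p).
have cX := side_point_continuous (i + n)%N continuous_param1.
have cY := side_point_continuous (j + n)%N continuous_param2.
have cu := @plane_continuous_nvec R.
apply: closed_and; first by apply: closed_eq0; exact: continuous_det2.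
apply: closed_and; first by apply: closed_ge0; exact: continuous_dot2.
apply: closed_and; first by apply: closed_eq0; exact: continuous_det2.
have cuy := @continuous_dot2 R _ _ cu cy.
have cW := @continuous_dot2 R _ _ (plane_continuous_cst (nvec th))
  (plane_continuousB cX cY).
apply: closed_and; apply: closed_ge0 => w; first exact: (continuous_atN (cuy w)).
exact: (continuous_atM (continuous_at_cst e w) (cW w)).
Qed.

Lemma ray_chordP e th ph i j s r : 0 <= s <= 1 -> 0 <= r <= 1 ->
  ray_chord e th ph i j s r -> chord i j s r.
Proof.
move=> s01 r01 [d1 [g1 [d2 [g2 _]]]].
have u0 := nvec_neq0 ph; have uu := dot2_gt0 u0.
have [a aE] := det2_eq0_coll u0 d1; have [b bE] := det2_eq0_coll u0 d2.
have dotZ c : dot2 (nvec ph) (c *: nvec ph) = c * dot2 (nvec ph) (nvec ph).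
  by coords; ring.
move: g1 g2; rewrite aE bE !dotZ -mulNr !pmulr_lge0 // => a0 b0.
split=> //; rewrite aE bE; first by coords; ring.
have -> : dot2 (a *: nvec ph) (b *: nvec ph) = (a * b) * dot2 (nvec ph) (nvec ph).
  by coords; ring.
by rewrite pmulr_lle0 // mulr_ge0_le0 //; lra.
Qed.

Lemma bpt_neq_p i s : bpt i s != p.
Proof. by apply: contraTneq (hp i) => <-; rewrite hgt_bpt_self ltxx. Qed.

Lemma side_modE i s : bpt i s = bpt (i %% d) s.
Proof. by apply: (bpt_eqmod HP); rewrite modn_mod. Qed.

Lemma ray_exists th ph : exists i j s r, [/\ (i < d)%N, (j < d)%N,
  0 <= s <= 1, 0 <= r <= 1 & ray_chord 0 th ph i j s r].
Proof.
have u0 := nvec_neq0 ph; have uu := dot2_gt0 u0.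
have [i [s [a [s01 a0 iE]]]] := ray_exit HP hp u0.
have [|j [r [b [r01 b0 jE]]]] := @ray_exit _ _ _ HP _ hp (- nvec ph).
  by rewrite oppr_eq0.
have pK (v : R * R) : p + v - p = v by rewrite addrC addKr.
exists (i %% d)%N, (j %% d)%N, s, r; split; rewrite ?ltn_mod ?(sides_gt0 HP) //.
rewrite /ray_chord -!side_modE iE jE !pK mul0r lexx.
have -> : det2 (nvec ph) (a *: nvec ph) = 0 by coords; ring.
have -> : det2 (nvec ph) (b *: - nvec ph) = 0 by coords; ring.
have -> : dot2 (nvec ph) (a *: nvec ph) = a * dot2 (nvec ph) (nvec ph) by coords; ring.
have -> : - dot2 (nvec ph) (b *: - nvec ph) = b * dot2 (nvec ph) (nvec ph) by coords; ring.
by rewrite !mulr_ge0 // ltW.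
Qed.

Lemma ray_cover th ph : ray_set 1 th ph \/ ray_set (-1) th ph.
Proof.
have [i [j [s [r [id jd s01 r01 [h1 [h2 [h3 [h4 _]]]]]]]]] := ray_exists th ph.
have [h|h] := leP 0 (dot2 (nvec th) (bpt (i + n) s - bpt (j + n) r)); [left|right];
  exists i; split=> //; exists j; split=> //; exists s, r; split=> //;
  do 4?split=> //; rewrite ?mul1r ?mulN1r //; lra.
Qed.

(** Adding [pi] to the angle of the ray exchanges the two ends and changes the
    sign of the transformed direction. *)
Lemma ray_swap e th i j s r : ray_chord e th 0 i j s r ->
  ray_chord (- e) th pi j i r s.
Proof.
rewrite /ray_chord /nvec cos0 sin0 cospi sinpi; coords.
by move=> [h1 [h2 [h3 [h4 h5]]]]; do 4?split; lra.
Qed.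

(** An intermediate value argument on the angle of the original line.  The two
    sign conditions define closed sets which cover the angles from [0] to [pi]
    and are exchanged between these two; at a common angle both signs hold for
    the same chord, because the ends of a chord do not depend on the sides
    chosen for them. *)
Lemma zero_normal th : exists i j s r, chord i j s r /\
  dot2 (nvec th) (bpt (i + n) s - bpt (j + n) r) = 0.
Proof.
have swap e : ray_set e th 0 -> ray_set (- e) th pi.
  move=> [i [id [j [jd [s [r [s01 r01 h]]]]]]].
  by exists j; split=> //; exists i; split=> //; exists r, s; split=> //; exact: ray_swap.
have [||ph [_ [i [_ [j [_ [s [r [s01 r01 h]]]]]]] [i' [_ [j' [_ [s' [r' [s'01 r'01
  h']]]]]]]]] :=
  segment_meet (pi_ge0 R) (@ray_set_closed 1 th) (@ray_set_closed (-1) th)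
    (fun t _ => ray_cover th t).
- exact: swap.
- by move/swap; rewrite opprK.
have c := ray_chordP s01 r01 h; have c' := ray_chordP s'01 r'01 h'.
exists i, j, s, r; split=> //.
have u0 := nvec_neq0 ph.
case: h => d1 [g1 [d2 [g2 S]]]; case: h' => d1' [g1' [d2' [g2' S']]].
have w : det2 (bpt i s - bpt j r) (bpt i' s' - bpt j' r') = 0.
  have [a aE] := det2_eq0_coll u0 d1; have [b bE] := det2_eq0_coll u0 d2.
  have [a' aE'] := det2_eq0_coll u0 d1'; have [b' bE'] := det2_eq0_coll u0 d2'.
  have -> : bpt i s - bpt j r = (bpt i s - p) - (bpt j r - p) by rewrite opprB addrA subrK.
  have -> : bpt i' s' - bpt j' r' =
    (bpt i' s' - p) - (bpt j' r' - p) by rewrite opprB addrA subrK.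
  by rewrite aE bE aE' bE' -!scalerBl; coords; ring.
have [[xE yE]|[xE yE]] := chord_same_line HP hp c c' w.
  move: S S'; rewrite (shift_wd HP s'01 s01 xE) (shift_wd HP r'01 r01 yE).
  by rewrite mul1r mulN1r => S1 S2; lra.
have := bpt_neq_p j r; move: g1'; rewrite xE => g1'.
have g0 : dot2 (nvec ph) (bpt j r - p) = 0 by lra.
have [a aE] := det2_eq0_coll u0 d2.
move: g0; rewrite aE.
have -> : dot2 (nvec ph) (a *: nvec ph) = a * dot2 (nvec ph) (nvec ph) by coords; ring.
move/eqP; rewrite mulf_eq0 (gt_eqF (dot2_gt0 u0)) orbF => /eqP a0.
by rewrite -subr_eq0 aE a0 scale0r eqxx.
Qed.

(** The original line, given by its chord, of the transformed line with normal
    [nvec th]; orienting the transformed chord along [tvec th] fixes which end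
    is called [x]. *)
Record line_at th i j s r : Prop := LineAt {
  line_chord : chord i j s r;
  line_normal : dot2 (nvec th) (bpt (i + n) s - bpt (j + n) r) = 0;
  line_dir : 0 < dot2 (tvec th) (bpt (i + n) s - bpt (j + n) r) }.

Lemma line_dir_neq0 th i j s r : chord i j s r ->
  dot2 (nvec th) (bpt (i + n) s - bpt (j + n) r) = 0 ->
  dot2 (tvec th) (bpt (i + n) s - bpt (j + n) r) != 0.
Proof.
move=> c n0; have := transverse_neq (chord_transverse_shift HP hp c).
apply: contra => /eqP t0; rewrite -subr_eq0 (frame_decomp th (_ - _)) n0 t0.
by rewrite !scale0r addr0.
Qed.

Lemma line_at_exists th : exists i j s r, [/\ (i < d)%N, (j < d)%N & line_at th i j s r].
Proof.
suff [i [j [s [r [[s01 r01 h1 h2] h3 h4]]]]] : exists i j s r, line_at th i j s r.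
  have E k e : bpt (k + n) e = bpt (k %% d + n) e.
    by apply: (bpt_eqmod HP); rewrite modnDml.
  exists (i %% d)%N, (j %% d)%N, s, r; rewrite !ltn_mod !(sides_gt0 HP).
  by split=> //; split; [split; rewrite -?side_modE | rewrite -!E | rewrite -!E].
have [i [j [s [r [c n0]]]]] := zero_normal th.
have := line_dir_neq0 c n0; rewrite neq_lt => /orP[t0|t0]; last first.
  by exists i, j, s, r.
exists j, i, r, s; split.
- exact: chordC.
- by move: n0; coords; lra.
by move: t0; coords; lra.
Qed.

Lemma line_at_unique th i j s r i' j' s' r' :
  line_at th i j s r -> line_at th i' j' s' r' ->
  bpt i' s' = bpt i s /\ bpt j' r' = bpt j r.
Proof.
move=> [c n0 t0] [c' n0' t0'].
have W : det2 (bpt (i + n) s - bpt (j + n) r) (bpt (i' + n) s' - bpt (j' + n) r') = 0.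
  rewrite (frame_decomp th (_ - bpt (j + n) r)) n0 (frame_decomp th (_ - bpt (j'
    + n) r')) n0'.
  by rewrite !scale0r !add0r; coords; ring.
have [//|[xE yE]] := chord_unique HP hp c c' W.
move: t0'; rewrite (shift_wd HP (chord_s c') (chord_r c) xE).
rewrite (shift_wd HP (chord_r c') (chord_s c) yE) => t0'.
by exfalso; move: t0 t0'; coords; lra.
Qed.

Definition cell_set i j : set R := [set th | exists s r, line_at th i j s r].

(** The strict sign condition may be weakened, since the transformed chord never
    vanishes; then the set is a projection along a compact square. *)
Lemma cell_set_closed i j : closed (cell_set i j).
Proof.
pose C : set (R * (R * R)) := [set w |
  det2 (bpt i w.2.1 - p) (bpt j w.2.2 - p) = 0 /\
  (0 <= - dot2 (bpt i w.2.1 - p) (bpt j w.2.2 - p) /\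
  (dot2 (nvec w.1) (bpt (i + n) w.2.1 - bpt (j + n) w.2.2) = 0 /\
  0 <= dot2 (tvec w.1) (bpt (i + n) w.2.1 - bpt (j + n) w.2.2)))].
have -> : cell_set i j = [set t | exists s r, [/\ 0 <= s <= 1, 0 <= r <= 1 & C (t,
  (s, r))]].
  apply/seteqP; split=> t [s [r]].
    move=> [[s01 r01 h1 h2] h3 h4]; exists s, r; split=> //.
    by split=> //=; split; [rewrite oppr_ge0|split=> //; exact: ltW].
  move=> [s01 r01 [/= h1 [h2 [h3 h4]]]]; exists s, r.
  have c : chord i j s r by split=> //; rewrite -oppr_ge0.
  by split=> //; rewrite lt_neqAle h4 andbT eq_sym line_dir_neq0.
apply: closed_projection.
have cx := plane_continuousB (side_point_continuous i continuous_param1)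
  (plane_continuous_cst p).
have cy := plane_continuousB (side_point_continuous j continuous_param2)
  (plane_continuous_cst p).
have cW := plane_continuousB (side_point_continuous (i + n)%N continuous_param1)
  (side_point_continuous (j + n)%N continuous_param2).
apply: closed_and; first by apply: closed_eq0; exact: continuous_det2.
apply: closed_and.
  have cxy := @continuous_dot2 R _ _ cx cy.
  by apply: closed_ge0 => w; exact: (continuous_atN (cxy w)).
apply: closed_and.
  by apply: closed_eq0; exact: (continuous_dot2 (@plane_continuous_nvec R)).
by apply: closed_ge0; exact: (continuous_dot2 (@plane_continuous_tvec R)).
Qed.

End Existence.

(** * Transformed lines and transitions *)

Section Family.
Context {R : realType} {n : nat} {P : nat -> R * R} (HP : cppos n P).
Context {p : R * R}.
Implicit Types (i j k m : nat) (s t r : R) (x y z : R * R) (l : set (R * R)).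
Local Notation d := n.*2.
Local Notation bpt := (side_point P).
Local Notation hgt := (height P).
Local Notation chord := (@chord R P p).
Local Notation line_at := (@line_at R n P p).
Local Notation cell_set := (@cell_set R n P p).

(** A point of the region at height [0] leaves the region by an arbitrarily small
    step across the line of side [k]. *)
Lemma interior_height : interior (region P) p -> forall k, 0 < hgt k p.
Proof.
move=> Hp k; rewrite lt_neqAle.
have rp : region P p by exact: nbhs_singleton Hp.
rewrite rp andbT eq_sym; apply/eqP => h0.
pose v : R * R := ((edge P k).2, - (edge P k).1).
have cf : {for 0, continuous (fun c : R => p + c *: v)}.
  apply: cvgD; first exact: cvg_cst.
  by apply: cvgZr_tmp; exact: cvg_id.
have : nbhs (0 : R) [set c | region P (p + c *: v)].
  by apply: cf; rewrite scale0r addr0.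
move=> /nbhs_ballP [e /= e0 be].
have : region P (p + (e / 2) *: v).
  apply: be; rewrite /ball /= sub0r normrN gtr0_norm ?divr_gt0 //.
  by rewrite ltr_pdivrMr // ltr_pMr // ltrDl.
move=> /(_ k); have := dot2_gt0 (edge_neq0 HP k).
have -> : det2 (edge P k) (p + (e / 2) *: v - P k) =
  hgt k p - e / 2 * dot2 (edge P k) (edge P k).
  by rewrite /height /v; coords; ring.
rewrite h0 sub0r => dd; rewrite oppr_ge0 leNgt mulr_gt0 //.
by rewrite divr_gt0.
Qed.

Lemma sigmaE i s : 0 <= s <= 1 -> sigma n P (bpt i s) = bpt (i + n) s.
Proof.
move=> s01; apply: get_unique; first by exists i, s.
by move=> y [j [r [r01 [xE ->]]]]; rewrite -/(side_point P j r) in xE;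
  exact: esym (shift_wd HP s01 r01 xE).
Qed.

Hypothesis hp : forall k, 0 < hgt k p.

Lemma pencil_chord l : pencil p l ->
  exists i j s r, chord i j s r /\ l = line_through (bpt i s) (bpt j r).
Proof.
move=> [lp [a [b [/eqP ab lE]]]]; rewrite {}lE in lp *.
have u0 : b - a != 0 by rewrite subr_eq0 eq_sym.
have [i [s [e [s01 e0 iE]]]] := ray_exit HP hp u0.
have [|j [r [f [r01 f0 jE]]]] := @ray_exit _ _ _ HP _ hp (- (b - a)).
  by rewrite oppr_eq0.
have c : chord i j s r.
  split=> //; rewrite iE jE; first by coords; ring.
  have -> : dot2 (p + e *: (b - a) - p) (p + f *: (- (b - a)) - p) =
    - (e * f * dot2 (b - a) (b - a)) by coords; ring.
  by rewrite oppr_le0 !mulr_ge0 // ltW // dot2_gt0.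
exists i, j, s, r; split=> //.
have ne := transverse_neq (chord_transverse HP hp c).
have lp' : det2 (b - a) (p - a) = 0 := lp.
apply: line_through_eq => //; rewrite /line_through /= ?iE ?jE.
  by rewrite -[RHS]lp'; coords; ring.
by rewrite -[RHS]lp'; coords; ring.
Qed.

Lemma chord_pencil i j s r : chord i j s r ->
  pencil p (line_through (bpt i s) (bpt j r)).
Proof.
move=> c; have ne := transverse_neq (chord_transverse HP hp c).
split; last by exists (bpt i s), (bpt j r); split=> //; exact/eqP.
have [e [_ ->]] := chord_lerp hp c.
by apply/line_throughP => //; exists e.
Qed.

Lemma boundary_line i j s r z : chord i j s r ->
  (boundary P `&` line_through (bpt i s) (bpt j r)) z -> z = bpt i s \/ z = bpt j r.
Proof.
move=> c [[k [t [t01 ->]]]]; rewrite -/(side_point P k t) => lz.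
exact: (line_boundary HP (chord_s c) (chord_r c) t01 (chord_transverse HP hp c) lz).
Qed.

Lemma boundary_ends i j s r : chord i j s r ->
  (boundary P `&` line_through (bpt i s) (bpt j r)) (bpt i s) /\
  (boundary P `&` line_through (bpt i s) (bpt j r)) (bpt j r).
Proof.
move=> c; have [h1 h2] := line_through_ends (bpt i s) (bpt j r).
split; split=> //; [exists i, s|exists j, r]; split=> //.
  exact: chord_s c.
exact: chord_r c.
Qed.

(** The line meets the boundary exactly in the ends of its chord. *)
Lemma PhiE i j s r : chord i j s r ->
  Phi n P (line_through (bpt i s) (bpt j r)) =
  line_through (bpt (i + n) s) (bpt (j + n) r).
Proof.
move=> c; have [b1 b2] := boundary_ends c.
have ne := transverse_neq (chord_transverse HP hp c).
have sx := sigmaE i (chord_s c); have sy := sigmaE j (chord_r c).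
apply/seteqP; split=> z; last first.
  by move=> lz; exists (bpt i s), (bpt j r); split; rewrite ?sx ?sy //; exact/eqP.
move=> [x [y [xy /(boundary_line c) [xE|xE] /(boundary_line c) [yE|yE]]]];
  rewrite xE yE in xy *; rewrite ?sx ?sy //.
by rewrite line_throughC.
Qed.

Lemma normal_lineE t x y : x != y -> dot2 (nvec t) (x - y) = 0 ->
  normal_line p t (dot2 (nvec t) (x - p)) = line_through x y.
Proof.
move=> xy n0; apply/seteqP; split=> z.
  rewrite /normal_line /line_through /= => zE.
  have n1 : dot2 (nvec t) (z - x) = 0 by move: zE; coords; lra.
  have n2 : dot2 (nvec t) (y - x) = 0 by move: n0; coords; lra.
  rewrite (frame_decomp t (y - x)) (frame_decomp t (z - x)) n1 n2 !scale0r !add0r.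
  by coords; ring.
move=> /(line_throughP _ xy) [m ->]; rewrite /normal_line /=.
have -> : dot2 (nvec t) (x + m *: (y - x) - p) =
   dot2 (nvec t) (x - p) - m * dot2 (nvec t) (x - y) by coords; ring.
by rewrite n0 mulr0 subr0.
Qed.

Lemma normal_line_inv t c x y : normal_line p t c = line_through x y ->
  c = dot2 (nvec t) (x - p) /\ dot2 (nvec t) (x - y) = 0.
Proof.
move=> E; have [] := line_through_ends x y; rewrite -E /normal_line /= => <-.
by move=> yE; split=> //; move: yE; coords; lra.
Qed.

Lemma shift_neq i j s r : chord i j s r -> bpt (i + n) s != bpt (j + n) r.
Proof. by move=> c; exact: transverse_neq (chord_transverse_shift HP hp c). Qed.

Lemma pencil_line_at t c l : pencil p l -> Phi n P l = normal_line p t c ->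
  exists i j s r, line_at t i j s r /\ l = line_through (bpt i s) (bpt j r).
Proof.
move=> /pencil_chord [i [j [s [r [ch ->]]]]]; rewrite PhiE // => /esym E.
have [_ n0] := normal_line_inv E.
have := line_dir_neq0 HP hp ch n0; rewrite neq_lt => /orP[t0|t0]; last first.
  by exists i, j, s, r.
exists j, i, r, s; rewrite line_throughC; split=> //; split.
- exact: chordC.
- by move: n0; coords; lra.
by move: t0; coords; lra.
Qed.

Section AtAngle.
Context {t : R} {i j : nat} {s r : R} (L : line_at t i j s r).

Lemma Phi_line_at : Phi n P (line_through (bpt i s) (bpt j r)) =
  normal_line p t (dot2 (nvec t) (bpt (i + n) s - p)).
Proof.
by case: L => c n0 _; rewrite PhiE // (normal_lineE (shift_neq c)).
Qed.

Lemma pencil_line_unique c l : pencil p l -> Phi n P l = normal_line p t c ->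
  l = line_through (bpt i s) (bpt j r) /\ c = dot2 (nvec t) (bpt (i + n) s - p).
Proof.
move=> pl E; have [i' [j' [s' [r' [L' lE]]]]] := pencil_line_at pl E.
have [xE yE] := line_at_unique HP hp L L'.
split; first by rewrite lE xE yE.
by move: E; rewrite lE xE yE (PhiE (line_chord L)) => /esym /normal_line_inv [-> _].
Qed.

Lemma qfun_line_at : qfun n P p t = dot2 (nvec t) (bpt (i + n) s - p).
Proof.
apply: get_unique.
  exists (line_through (bpt i s) (bpt j r)); last exact: Phi_line_at.
  exact: chord_pencil (line_chord L).
by move=> c [l pl E]; have [] := pencil_line_unique pl E.
Qed.

Lemma original_lineE l :
  original_line n P p t l <-> l = line_through (bpt i s) (bpt j r).
Proof.
split=> [[pl E]|->]; first by have [] := pencil_line_unique pl E.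
split; first exact: chord_pencil (line_chord L).
by rewrite qfun_line_at Phi_line_at.
Qed.

(** A vertex on the original line is one of the two ends of the chord, and only
    the ends of a side are vertices. *)
Lemma transitionE :
  transition n P p t <-> [\/ s = 0, s = 1, r = 0 | r = 1].
Proof.
split.
  move=> [l [k [/original_lineE -> lk]]].
  have bk : boundary P (P k).
    by exists k, 0; rewrite lexx ler01 scale0r addr0.
  have [/(vertex_bpt HP)|/(vertex_bpt HP)] := boundary_line (line_chord L) (conj bk lk).
    by move=> [[_ ->]|[_ ->]]; [constructor 1|constructor 2].
  by move=> [[_ ->]|[_ ->]]; [constructor 3|constructor 4].
have [h1 h2] := line_through_ends (bpt i s) (bpt j r).
have oE : original_line n P p t (line_through (bpt i s) (bpt j r)) by apply/original_lineE.
move=> sr; exists (line_through (bpt i s) (bpt j r)).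
case: sr => E.
- by exists i; split=> //; rewrite -[X in _ X]bpt0 -E.
- by exists i.+1; split=> //; rewrite -[X in _ X]bpt1 -E.
- by exists j; split=> //; rewrite -[X in _ X]bpt0 -E.
- by exists j.+1; split=> //; rewrite -[X in _ X]bpt1 -E.
Qed.

Lemma nontransition_open : ~ transition n P p t -> 0 < s < 1 /\ 0 < r < 1.
Proof.
move=> nt.
have [s0|s1|si] := itv01P (chord_s (line_chord L)).
- by case: nt; apply/transitionE; constructor 1.
- by case: nt; apply/transitionE; constructor 2.
have [r0|r1|ri] := itv01P (chord_r (line_chord L)).
- by case: nt; apply/transitionE; constructor 3.
- by case: nt; apply/transitionE; constructor 4.
by split.
Qed.

End AtAngle.

Lemma open_side_vertex i k s : 0 < s < 1 -> P k <> bpt i s.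
Proof.
move=> /andP[s0 s1] /(vertex_bpt HP) [[_ E]|[_ E]]; move: s0 s1; rewrite E ltxx //.
Qed.

Lemma fixed_sides_nontransition a b t : fixed_sides n P p a b -> a < t < b ->
  ~ transition n P p t.
Proof.
move=> [i [j fs]] /fs [l [x [y [ol xy [sx lx] [sy ly]]]]].
have [i' [j' [s [r [_ _ L]]]]] := line_at_exists HP hp t.
move=> [l' [k [ol' lk]]].
move/(original_lineE L): ol => lE; move/(original_lineE L): ol' => lE'.
rewrite {}lE in lx ly; rewrite {}lE' in lk.
have open_bd m z : open_side P m z -> boundary P z /\ P k <> z.
  move=> [e [e01 ->]]; split; last exact: open_side_vertex.
  by exists m, e; split=> //; case/andP: e01 => e0 e1; rewrite !ltW.
have [bx kx] := open_bd _ _ sx; have [by_ ky] := open_bd _ _ sy.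
have bk : boundary P (P k) by exists k, 0; rewrite lexx ler01 scale0r addr0.
have := boundary_line (line_chord L) (conj bx lx).
have := boundary_line (line_chord L) (conj by_ ly).
have := boundary_line (line_chord L) (conj bk lk).
move=> [kE|kE] [yE|yE] [xE|xE]; try (by apply: xy; rewrite xE yE);
 try (by apply: kx; rewrite kE xE); by apply: ky; rewrite kE yE.
Qed.

Lemma open_side_index i j s r : 0 < s < 1 -> 0 <= r <= 1 -> bpt i s = bpt j r ->
  i = j %[mod d].
Proof.
move=> si r01 E.
have [h1 h2] : hgt j (P i) = 0 /\ hgt j (P i.+1) = 0.
  by apply: (convex_eq0 si); rewrite ?(hgt_vertex_ge0 HP) // -hgt_bpt E hgt_bpt_self.
exact: (edge_on_line HP h1 h2).
Qed.

(** Off the transitions the chord has its ends on open sides, so the angle lies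
    in none of the finitely many other closed sets [cell_set i' j']. *)
Lemma cell_set_nbhs i j t : (i < d)%N -> (j < d)%N -> ~ transition n P p t ->
  cell_set i j t -> nbhs t (cell_set i j).
Proof.
move=> id jd nt [s [r L]].
pose D : set (nat * nat) := (`I_d `*` `I_d) `\ (i, j).
have fD : finite_set D.
  by apply: sub_finite_set (finite_setX (finite_II d) (finite_II d)) => z [].
have cD : closed (\bigcup_(z in D) cell_set z.1 z.2).
  by apply: closed_bigcup => // z _; exact: cell_set_closed.
have [si ri] := nontransition_open L nt.
have : nbhs t (~` (\bigcup_(z in D) cell_set z.1 z.2)).
  apply: open_nbhs_nbhs; split; first exact: closed_openC.
  move=> [[i' j'] [[/= i'd j'd] ne] [s' [r' L']]]; apply: ne.
  have [xE yE] := line_at_unique HP hp L L'.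
  have := open_side_index si (chord_s (line_chord L')) (esym xE).
  have := open_side_index ri (chord_r (line_chord L')) (esym yE).
  by rewrite !modn_small // => -> ->.
apply: filterS => u nu.
have [i' [j' [s' [r' [i'd j'd L']]]]] := line_at_exists HP hp u.
have [[-> ->]|ne] := eqVneq (i, j) (i', j'); first by exists s', r'.
case: nu; exists (i', j'); last by exists s', r'.
by split=> //= E; move: ne; rewrite E eqxx.
Qed.
End Family.

(** * Cells of the family and the support function *)

Lemma sin_eq0_small {R : realType} (x : R) : - pi < x < pi -> sin x = 0 -> x = 0.
Proof.
move=> /andP[xl xr] s0; have [x0|x0|//] := ltgtP x 0.
  have : 0 < sin (- x) by apply: sin_gt0_pi; apply/andP; split; lra.
  by rewrite sinN s0 oppr0 ltxx.
have : 0 < sin x by apply: sin_gt0_pi; rewrite x0.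
by rewrite s0 ltxx.
Qed.

Section Cells.
Context {R : realType} {n : nat} {P : nat -> R * R} (HP : cppos n P).
Context {p : R * R} (hp : forall k, 0 < height P k p).
Implicit Types (i j k m : nat) (s t r : R) (x y z : R * R) (l : set (R * R)).
Local Notation d := n.*2.
Local Notation bpt := (side_point P).
Local Notation hgt := (height P).
Local Notation line_at := (@line_at R n P p).
Local Notation cell_set := (@cell_set R n P p).
Local Notation q := (qfun n P p).

(** A closed set contains the closure of an open interval. *)
Lemma closed_segment_of_open (A : set R) (a b : R) : a < b -> closed A ->
  (forall t, a < t < b -> A t) -> forall t, a <= t <= b -> A t.
Proof.
move=> ab cA oA t /andP[ta tb]; apply: cA => B /nbhs_ballP [e /= e0 eB].
pose c := (a + b) / 2.
(* Move t towards the midpoint c by the fraction m of the distance. *)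
pose m := Num.min 1 (e / (2 * (b - a))).
have ba0 : 0 < b - a by rewrite subr_gt0.
have m0 : 0 < m by rewrite lt_min ltr01 divr_gt0 // mulr_gt0.
have m1 : m <= 1 by rewrite ge_min lexx.
have me : m * (b - a) <= e / 2.
  have : m <= e / (2 * (b - a)) by rewrite ge_min lexx orbT.
  rewrite -(ler_pM2r ba0) => /le_trans; apply; rewrite invfM mulrA divfK //.
  by rewrite gt_eqF.
have cE : c - a = (b - a) / 2 /\ b - c = (b - a) / 2 by rewrite /c; split; lra.
exists (t + m * (c - t)); split.
  have ta' : 0 <= (1 - m) * (t - a) by rewrite mulr_ge0 // subr_ge0.
  have tb' : 0 <= (1 - m) * (b - t) by rewrite mulr_ge0 // subr_ge0.
  have ca : 0 < m * (c - a) by rewrite mulr_gt0 // cE.1 divr_gt0.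
  have cb : 0 < m * (b - c) by rewrite mulr_gt0 // cE.2 divr_gt0.
  by apply: oA; apply/andP; split; lra.
apply: eB; rewrite /ball /= opprD addNKr normrN normrM (gtr0_norm m0).
have ct : `|c - t| <= b - a by rewrite ler_norml; apply/andP; split; lra.
apply: (@le_lt_trans _ _ (m * (b - a))); first by rewrite ler_pM2l.
lra.
Qed.

(** On an interval without transitions the closed set of angles with given
    sides is relatively open, hence is the whole interval by connectedness; being
    closed it also contains the two ends of the interval. *)
Lemma nontransition_cell a b : a < b ->
  (forall t, a < t < b -> ~ transition n P p t) ->
  exists i j, forall t, a <= t <= b -> cell_set i j t.
Proof.
move=> ab nt; pose m := (a + b) / 2.
have mab : a < m < b by rewrite /m; apply/andP; split; lra.
have [i [j [s [r [id jd L]]]]] := line_at_exists HP hp m.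
exists i, j; apply: closed_segment_of_open => //; first exact: cell_set_closed.
(* The set of angles with these sides is both open and closed in the interval. *)
have E : `]a, b[%classic `&` cell_set i j = `]a, b[%classic.
  have : connected `]a, b[%classic by apply/connected_intervalP;
    exact: interval_is_interval.
  apply; first by exists m; split; [rewrite /= in_itv|exists s, r].
    exists (interior (cell_set i j)); first exact: open_interior.
    apply/seteqP; split=> t [tab ct]; split=> //.
      by apply: cell_set_nbhs => //; apply: nt; move: tab; rewrite /= in_itv.
    exact: nbhs_singleton ct.
  by exists (cell_set i j) => //; exact: cell_set_closed.
move=> t tab; have : (`]a, b[%classic `&` cell_set i j) t by rewrite E /= in_itv.
by case.
Qed.

Lemma nontransition_fixed_sides a b : a < b ->
  (forall t, a < t < b -> ~ transition n P p t) -> fixed_sides n P p a b.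
Proof.
move=> ab nt; have [i [j cell]] := nontransition_cell ab nt.
exists i, j => t tab; have [|s [r L]] := cell t.
  by case/andP: tab => h1 h2; rewrite !ltW.
have [si ri] := nontransition_open HP hp L (nt t tab).
exists (line_through (bpt i s) (bpt j r)), (bpt i s), (bpt j r).
have [h1 h2] := line_through_ends (bpt i s) (bpt j r).
split.
- exact/(original_lineE HP hp L).
- exact/eqP/(transverse_neq (chord_transverse HP hp (line_chord L))).
- by split=> //; exists s.
- by split=> //; exists r.
Qed.

Lemma nontransition_near t : ~ transition n P p t ->
  exists i j, nbhs t (cell_set i j).
Proof.
move=> nt; have [i [j [s [r [id jd L]]]]] := line_at_exists HP hp t.
by exists i, j; apply: cell_set_nbhs => //; exists s, r.
Qed.

Lemma nvecDpi t : nvec (t + pi) = - nvec t :> R * R.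
Proof. by rewrite /nvec cosDpi sinDpi. Qed.

Lemma tvecDpi t : tvec (t + pi) = - tvec t :> R * R.
Proof. by rewrite /tvec cosDpi sinDpi. Qed.

Lemma line_atDpi t i j s r : line_at t i j s r -> line_at (t + pi) j i r s.
Proof.
move=> [c n0 t0]; split; first exact: chordC.
  by move: n0; rewrite nvecDpi; coords; lra.
by move: t0; rewrite tvecDpi; coords; lra.
Qed.

Lemma qfunDpi t : q (t + pi) = - q t.
Proof.
have [i [j [s [r [_ _ L]]]]] := line_at_exists HP hp t.
rewrite (qfun_line_at HP hp L) (qfun_line_at HP hp (line_atDpi L)).
by move: (line_normal L); rewrite nvecDpi; coords; lra.
Qed.

Lemma nvec_det t t' : det2 (nvec t) (nvec t') = sin (t' - t).
Proof. by rewrite sinB /det2 /nvec /=; ring. Qed.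

Lemma parallel_normals t t' : 0 <= t < pi -> 0 <= t' < pi ->
  det2 (nvec t) (nvec t') = 0 -> t = t'.
Proof.
rewrite nvec_det => /andP[t0 tp] /andP[t0' tp'] /sin_eq0_small E.
by apply/esym/eqP; rewrite -subr_eq0 E //; apply/andP; split; lra.
Qed.

(** The original line through [P k] is determined by [k], and it determines the
    normal up to sign. *)
Lemma vertex_transition_unique k t t' : 0 <= t < pi -> 0 <= t' < pi ->
  (exists l, original_line n P p t l /\ l (P k)) ->
  (exists l, original_line n P p t' l /\ l (P k)) -> t = t'.
Proof.
move=> tp tp' [l [ol lk]] [l' [ol' lk']]; apply: parallel_normals => //.
have pk : p != P k by rewrite eq_sym -[P k]bpt0; apply: bpt_neq_p.
have lineE (m : set (R * R)) : pencil p m -> m (P k) -> m = line_through p (P k).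
  by move=> [mp [a [b [/eqP ab E]]]] mk; rewrite E in mp mk *; exact: line_through_eq.
have llE : l = l' by rewrite (lineE l ol.1 lk) (lineE l' ol'.1 lk').
have [i [j [s [r [_ _ L]]]]] := line_at_exists HP hp t.
have [_ E1] := ol; have [_ E2] := ol'.
move/(original_lineE HP hp L): ol => lE.
rewrite -llE lE (PhiE HP hp (line_chord L)) in E2.
have [_ n0'] := normal_line_inv (esym E2).
have n0 := line_normal L.
move: n0'; rewrite (frame_decomp t (_ - _)) n0 scale0r add0r.
have -> : forall c, dot2 (nvec t') (c *: tvec t) = c * det2 (nvec t) (nvec t').
  by move=> c; rewrite /nvec /tvec; coords; ring.
by move/eqP; rewrite mulf_eq0 (gt_eqF (line_dir L)) => /eqP.
Qed.

Lemma transitions_finite : finite_set (transition n P p `&` `[0, pi[%classic).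
Proof.
pose T k : set R := [set t | 0 <= t < pi /\ exists l, original_line n P p t l /\ l (P k)].
apply: (@sub_finite_set _ _ (\bigcup_(k in `I_d) T k)).
  move=> t [[l [k [ol lk]]]]; rewrite /= in_itv /= => tp.
  exists (k %% d)%N; first by rewrite /= ltn_mod (sides_gt0 HP).
  by split=> //; exists l; split=> //; rewrite (vertex_mod HP).
apply: bigcup_finite => [|k _]; first exact: finite_II.
have [[t Tt]|nT] := pselect (exists t, T k t); last first.
  by rewrite (_ : T k = set0) //; apply/seteqP; split=> // t Tt; apply: nT; exists t.
apply: (sub_finite_set _ (finite_set1 t)) => u Tu /=.
by apply: (@vertex_transition_unique k); [exact: Tu.1|exact: Tt.1|exact: Tu.2|exact: Tt.2].
Qed.

(** Solving [nvec t . (X - p) = c] for the parameter of [X] on side [i + n] and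
    substituting it in [x - p] gives a quotient with denominator
    [nvec t . edge P (i + n)]; its numerator is [cleared i t + c *: edge P i]
    (see [clearedE]). *)
Definition cleared i t : R * R :=
  dot2 (nvec t) (edge P (i + n)) *: (P i - p) - dot2 (nvec t) (P (i + n)%N - p) *: edge P i.

Definition quad2 i j : R := det2 (edge P i) (edge P j).
Definition quad1 i j t : R := det2 (cleared i t) (edge P j) + det2 (edge P i) (cleared j t).
Definition quad0 i j t : R := det2 (cleared i t) (cleared j t).

Lemma clearedE i t s c : c = dot2 (nvec t) (bpt (i + n) s - p) ->
  cleared i t + c *: edge P i = dot2 (nvec t) (edge P (i + n)) *: (bpt i s - p).
Proof.
by move=> ->; rewrite /cleared /side_point; apply: plane_eq; coords; ring.
Qed.

(** The equation is [det2 (x - p) (y - p) = 0] with denominators cleared.  Its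
    derivative in [q] is a sum of two products of two factors: the slope of a
    transformed side against the normal and, up to a positive multiple, the
    height of an end of the chord over the side of the other end.  Convexity
    fixes the signs of these factors. *)
Lemma quadratic_root t i j s r : line_at t i j s r ->
  quad0 i j t + quad1 i j t * q t + quad2 i j * q t ^+ 2 = 0 /\
  0 < quad1 i j t + 2 * quad2 i j * q t.
Proof.
move=> L; have c := line_chord L; have qx := qfun_line_at HP hp L.
have qy : q t = dot2 (nvec t) (bpt (j + n) r - p).
  by rewrite qx; move: (line_normal L); coords; lra.
have Ai := clearedE qx; have Aj := clearedE qy.
split.
  have -> : quad0 i j t + quad1 i j t * q t + quad2 i j * q t ^+ 2 =
    det2 (cleared i t + q t *: edge P i) (cleared j t + q t *: edge P j).
    by rewrite /quad0 /quad1 /quad2; coords; ring.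
  rewrite Ai Aj.
  have -> : forall (a b : R) u v, det2 (a *: u) (b *: v) = a * b * det2 u v.
    by move=> *; coords; ring.
  by rewrite (chord_det c) mulr0.
have -> : quad1 i j t + 2 * quad2 i j * q t =
  det2 (cleared i t + q t *: edge P i) (edge P j) + det2 (edge P i) (cleared j t
    + q t *: edge P j).
  by rewrite /quad1 /quad2; coords; ring.
rewrite Ai Aj.
have -> : forall (a : R) u v, det2 (a *: u) v = a * det2 u v by move=> *; coords; ring.
have -> : forall (a : R) u v, det2 u (a *: v) = a * det2 u v by move=> *; coords; ring.
have k0 := line_dir L; set k := dot2 _ _ in k0.
have WE : bpt (i + n) s - bpt (j + n) r = k *: tvec t.
  by rewrite (frame_decomp t (_ - _)) (line_normal L) scale0r add0r.
have T := chord_transverse_shift HP hp c.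
have hX := transverse_gt0 (transverseC T); have hY := transverse_gt0 T.
(* The transformed chord is k tau, so products with n are determinants with it. *)
have detW u : k * dot2 (nvec t) u = det2 u (bpt (i + n) s - bpt (j + n) r).
  by rewrite WE /nvec /tvec; coords; ring.
have mu : dot2 (nvec t) (edge P (i + n)) < 0.
  rewrite -(pmulr_rlt0 _ k0) detW.
  have -> : det2 (edge P (i + n)) (bpt (i + n) s - bpt (j + n) r) =
    hgt (i + n) (bpt (i + n) s) - hgt (i + n) (bpt (j + n) r).
    by rewrite /height; coords; ring.
  by rewrite hgt_bpt_self sub0r oppr_lt0.
have nu : 0 < dot2 (nvec t) (edge P (j + n)).
  rewrite -(pmulr_rgt0 _ k0) detW.
  have -> : det2 (edge P (j + n)) (bpt (i + n) s - bpt (j + n) r) =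
    hgt (j + n) (bpt (i + n) s) - hgt (j + n) (bpt (j + n) r).
    by rewrite /height; coords; ring.
  by rewrite hgt_bpt_self subr0.
have [l [/andP[l0 l1] pE]] := chord_lerp hp c.
have T' := chord_transverse HP hp c.
have hx := transverse_gt0 (transverseC T'); have hy := transverse_gt0 T'.
have d1 : det2 (bpt i s - p) (edge P j) = - (l * hgt j (bpt i s)).
  have -> : det2 (bpt i s - p) (edge P j) = hgt j p - hgt j (bpt i s).
    by rewrite /height; coords; ring.
  by rewrite pE hgt_lerp hgt_bpt_self; ring.
have d2 : det2 (edge P i) (bpt j r - p) = (1 - l) * hgt i (bpt j r).
  have -> : det2 (edge P i) (bpt j r - p) = hgt i (bpt j r) - hgt i p.
    by rewrite /height; coords; ring.
  by rewrite pE hgt_lerp hgt_bpt_self; ring.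
rewrite d1 d2 mulrN -mulNr addr_gt0 // mulr_gt0 ?oppr_gt0 // mulr_gt0 //.
by rewrite subr_gt0.
Qed.

(** At the root selected by [quadratic_root] this is the square of the
    derivative of the quadratic. *)
Definition quad_disc i j t := quad1 i j t * quad1 i j t - 4 * quad0 i j t * quad2 i j.

(** The root at which the derivative is positive; when the sides are parallel
    the equation is linear. *)
Definition quad_root i j t : R :=
  if quad2 i j == 0 then - quad0 i j t * (quad1 i j t)^-1
  else (- quad1 i j t + Num.sqrt (quad_disc i j t)) * (2 * quad2 i j)^-1.

Lemma quad_rootE t i j : cell_set i j t -> 0 < quad_disc i j t /\ q t = quad_root i j t.
Proof.
move=> [s [r L]]; have [root pos] := quadratic_root L.
have dE : quad_disc i j t = (quad1 i j t + 2 * quad2 i j * q t) ^+ 2.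
  rewrite /quad_disc; apply/eqP; rewrite -subr_eq0; apply/eqP.
  transitivity (- 4 * quad2 i j * (quad0 i j t + quad1 i j t * q t + quad2 i j * q t ^+ 2)).
    by ring.
  by rewrite root mulr0.
split; first by rewrite dE exprn_gt0.
rewrite /quad_root; case: eqP => [C20|/eqP C2].
  move: root pos; rewrite C20 mulr0 !mul0r !addr0 => root pos.
  apply: (mulfI (lt0r_neq0 pos)); rewrite mulrC mulrC; move: root.
  by rewrite mulrCA divff ?lt0r_neq0 // mulr1; lra.
rewrite dE sqrtr_sqr gtr0_norm //.
by field.
Qed.

End Cells.

(** * Twice differentiable functions *)

Section SecondOrder.
Context {R : realType}.
Implicit Types (f g h : R -> R) (t : R) (A : set R).

(** The derivatives [f1] and [f2] are data, so that closure under the operations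
    can be checked at each point separately. *)
Definition C2at f f1 f2 t := [/\ is_derive t 1 f (f1 t), is_derive t 1 f1 (f2 t) &
  {for t, continuous f2}].
Definition C2on A f := exists f1 f2, forall t, A t -> C2at f f1 f2 t.

Lemma is_derive_cont f t l : is_derive t 1 f l -> {for t, continuous f}.
Proof.
by move=> [df _]; apply: differentiable_continuous; apply/derivable1_diffP.
Qed.

Lemma is_derive_add f g t a b : is_derive t 1 f a -> is_derive t 1 g b ->
  is_derive t 1 (fun x => f x + g x) (a + b).
Proof. by move=> df dg; exact: is_deriveD. Qed.

Lemma is_derive_opp f t a : is_derive t 1 f a -> is_derive t 1 (fun x => - f x) (- a).
Proof. by move=> df; exact: is_deriveN. Qed.

Lemma is_derive_mul f g t a b : is_derive t 1 f a -> is_derive t 1 g b ->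
  is_derive t 1 (fun x => f x * g x) (a * g t + f t * b).
Proof.
move=> df dg; have := @is_deriveM _ _ f g t 1 a b df dg.
by move=> H; apply: is_derive_eq; rewrite /GRing.scale /=; ring.
Qed.

Lemma is_derive_const (c t : R) : is_derive t 1 (fun _ => c) 0.
Proof. exact: is_derive_cst. Qed.

Lemma is_derive_comp h f t a b : is_derive (f t) 1 h a -> is_derive t 1 f b ->
  is_derive t 1 (fun x => h (f x)) (a * b).
Proof. by move=> dh df; have := @is_derive1_comp _ h f t a b dh df. Qed.

Lemma is_derive_inv f t a : f t != 0 -> is_derive t 1 f a ->
  is_derive t 1 (fun x => (f x)^-1) (- a / f t ^+ 2).
Proof.
move=> f0 df; have H := @is_deriveV _ f t a 1 f0 df.
by apply: is_derive_eq; rewrite /GRing.scale /=; field.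
Qed.

Lemma C2on_cst A c : C2on A (fun _ => c).
Proof.
exists (fun _ => 0), (fun _ => 0) => t _; split; try exact: is_derive_const.
exact: cvg_cst.
Qed.

Lemma C2on_cos A : C2on A cos.
Proof.
exists (fun x => - sin x), (fun x => - cos x) => t _; split.
- exact: is_derive_cos.
- by apply: is_derive_opp; exact: is_derive_sin.
- by apply: continuous_atN; exact: continuous_cos.
Qed.

Lemma C2on_sin A : C2on A sin.
Proof.
exists cos, (fun x => - sin x) => t _; split.
- exact: is_derive_sin.
- exact: is_derive_cos.
- by apply: continuous_atN; exact: continuous_sin.
Qed.

Lemma C2on_add A f g : C2on A f -> C2on A g -> C2on A (fun x => f x + g x).
Proof.
move=> [f1 [f2 hf]] [g1 [g2 hg]].
exists (fun x => f1 x + g1 x), (fun x => f2 x + g2 x) => t At.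
have [df df1 cf] := hf t At; have [dg dg1 cg] := hg t At.
by split; [exact: is_derive_add|exact: is_derive_add|exact: continuous_atD].
Qed.

Lemma C2on_opp A f : C2on A f -> C2on A (fun x => - f x).
Proof.
move=> [f1 [f2 hf]]; exists (fun x => - f1 x), (fun x => - f2 x) => t At.
have [df df1 cf] := hf t At.
by split; [exact: is_derive_opp|exact: is_derive_opp|exact: continuous_atN].
Qed.

Lemma C2on_mul A f g : C2on A f -> C2on A g -> C2on A (fun x => f x * g x).
Proof.
move=> [f1 [f2 hf]] [g1 [g2 hg]].
exists (fun x => f1 x * g x + f x * g1 x),
  (fun x => f2 x * g x + f1 x * g1 x + (f1 x * g1 x + f x * g2 x)) => t At.
have [df df1 cf] := hf t At; have [dg dg1 cg] := hg t At.
split; first exact: is_derive_mul.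
  by apply: is_derive_add; exact: is_derive_mul.
have cf0 := is_derive_cont df; have cf1 := is_derive_cont df1.
have cg0 := is_derive_cont dg; have cg1 := is_derive_cont dg1.
by apply: continuous_atD; apply: continuous_atD; apply: continuous_atM.
Qed.

Lemma C2on_comp A h h1 h2 f : (forall t, A t -> C2at h h1 h2 (f t)) ->
  C2on A f -> C2on A (fun x => h (f x)).
Proof.
move=> hh [f1 [f2 hf]].
exists (fun x => h1 (f x) * f1 x),
  (fun x => h2 (f x) * f1 x * f1 x + h1 (f x) * f2 x) => t At.
have [df df1 cf] := hf t At; have [dh dh1 ch] := hh t At.
have cf0 := is_derive_cont df; have cf1 := is_derive_cont df1.
split; first exact: is_derive_comp.
  by apply: is_derive_mul => //; exact: is_derive_comp.
have c1 : {for t, continuous (fun x => h1 (f x))}.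
  by apply: continuous_comp => //; exact: is_derive_cont dh1.
have c2 : {for t, continuous (fun x => h2 (f x))} by apply: continuous_comp.
by apply: continuous_atD; repeat apply: continuous_atM.
Qed.

Lemma C2on_inv A f : (forall t, A t -> f t != 0) -> C2on A f ->
  C2on A (fun x => (f x)^-1).
Proof.
move=> f0; apply: (@C2on_comp _ (fun x => x^-1) (fun x => - (x ^-1 * x^-1))
  (fun x => 2 * (x^-1 * (x^-1 * x^-1)))) => t /f0; set x := f t => x0.
have di : is_derive x 1 (fun x => x^-1) (- (x^-1 * x^-1)).
  have := @is_derive_inv id x 1 x0 (is_derive_id _ _) => H.
  by apply: is_derive_eq; field.
have ci := is_derive_cont di.
split => //.
  have := is_derive_opp (is_derive_mul di di) => H.
  by apply: is_derive_eq; field.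
by repeat apply: continuous_atM => //; exact: cvg_cst.
Qed.

Lemma C2on_sqrt A f : (forall t, A t -> 0 < f t) -> C2on A f ->
  C2on A (fun x => Num.sqrt (f x)).
Proof.
move=> f0; apply: (@C2on_comp _ Num.sqrt (fun x => (2 * Num.sqrt x)^-1)
  (fun x => - ((2 * Num.sqrt x)^-1 * (2 * (Num.sqrt x * Num.sqrt x))^-1))) => t /f0.
set x := f t => x0; have s0 : 0 < Num.sqrt x by rewrite sqrtr_gt0.
have ds := is_derive1_sqrt x0; have cs := is_derive_cont ds.
have s0' : Num.sqrt x != 0 by rewrite gt_eqF.
split => //.
  have dd : is_derive x 1 (fun x => 2 * Num.sqrt x) (Num.sqrt x)^-1.
    have := is_derive_mul (is_derive_const 2 x) ds => H.
    by apply: is_derive_eq; field.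
  have n0 : 2 * Num.sqrt x != 0 by rewrite mulf_neq0.
  have := @is_derive_inv (fun y => 2 * Num.sqrt y) x _ n0 dd => H.
  by apply: is_derive_eq; field.
have cc : {for x, continuous (fun _ => 2 : R)} by exact: cvg_cst.
have c2 : {for x, continuous (fun y => 2 * Num.sqrt y)} by exact: continuous_atM.
have css : {for x, continuous (fun y : R =>
  Num.sqrt y * Num.sqrt y)} by exact: continuous_atM.
have c2s : {for x, continuous (fun y : R => 2 * (Num.sqrt y * Num.sqrt y))}.
  exact: continuous_atM.
apply: continuous_atN; apply: continuous_atM.
  by apply: cvgV; [rewrite mulf_neq0|exact: c2].
by apply: cvgV; [rewrite !mulf_neq0|exact: c2s].
Qed.

End SecondOrder.

(** * Integrals over open intervals and primitives *)

Section Integrals.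
Context {R : realType}.
Implicit Types (f g h F : R -> R) (a b t : R).
Local Notation mu := (@lebesgue_measure R).

Lemma within_of_pointwise f a b : (forall t, a <= t <= b -> {for t, continuous f}) ->
  {within `[a, b], continuous f}.
Proof.
move=> cf; apply: continuous_in_subspaceT => t; rewrite inE /= in_itv /=; exact: cf.
Qed.

Lemma derive1_val f t l : is_derive t 1 f l -> derive1 f t = l.
Proof. by move=> df; rewrite derive1E; exact: derive_val. Qed.

Section Cell.
Context {h : R -> R} {a b : R}.
Hypotheses (ab : a < b) (ch : forall t, a <= t <= b -> {for t, continuous h}).

Lemma integrable_cell : mu.-integrable `[a, b] (EFin \o h).
Proof.
apply: continuous_compact_integrable; first exact: segment_compact.
exact: within_of_pointwise.
Qed.

Lemma Rintegral_open : \int[mu]_(t in `]a, b[) h t = \int[mu]_(t in `[a, b]) h t.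
Proof.
rewrite Rintegral_itv_bndo_bndc; last first.
  by apply: integrableS integrable_cell => //; exact: subset_itv_oo_cc.
rewrite Rintegral_itv_obnd_cbnd //.
by apply: integrableS integrable_cell => //; exact: subset_itv_oc_cc.
Qed.

Lemma FTC_open F : {within `[a, b], continuous F} ->
  (forall t, a < t < b -> is_derive t 1 F (h t)) ->
  \int[mu]_(t in `]a, b[) h t = F b - F a.
Proof.
move=> cF dF; rewrite Rintegral_open /Rintegral (@continuous_FTC2 _ h F) //.
- exact: within_of_pointwise.
- have [_ Fa Fb] := (continuous_within_itvP _ ab).1 cF.
  by split=> // t; rewrite in_itv /= => /dF [].
- by move=> t; rewrite in_itv /= => /dF /derive1_val.
Qed.

Lemma exists_primitive : exists H : R -> R, {within `[a, b], continuous H} /\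
  (forall t, a < t < b -> is_derive t 1 H (h t)).
Proof.
exists (fun x => \int[mu]_(t in `[a, x]) h t); split.
  by apply: parameterized_integral_continuous; [exact: ltW|exact: integrable_cell].
move=> t /andP[ta tb].
have cht : {for t, continuous h} by apply: ch; rewrite !ltW.
have [dH HE] := continuous_FTC1_closed tb integrable_cell ta cht.
by split; [exact: dH|rewrite -HE derive1E].
Qed.

End Cell.

(** Split the interval at the exceptional points and use the mean value theorem
    between them. *)
Lemma mono_except (E : seq R) f a b : a <= b -> {within `[a, b], continuous f} ->
  (forall t, a < t < b -> t \notin E -> exists2 l, is_derive t 1 f l & 0 <= l) ->
  f a <= f b.
Proof.
elim: E a b => [|e E IH] a b ab cf df.
  have ina : a \in `[a, b] by rewrite in_itv /= lexx.
  have inb : b \in `[a, b] by rewrite in_itv /= lexx ab.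
  apply: (@ger0_derive1_le_cc _ f a b) => // t; rewrite in_itv /= => tab;
    have [l dl l0] := df t tab isT; first by case: dl.
  by rewrite (derive1_val dl).
have [/andP[ae eb]|ne] := boolP (a < e < b).
  have sub1 : {within `[a, e], continuous f}.
    by apply: continuous_subspaceW cf; apply: subset_itvl; rewrite bnd_simp ltW.
  have sub2 : {within `[e, b], continuous f}.
    by apply: continuous_subspaceW cf; apply: subset_itvr; rewrite bnd_simp ltW.
  apply: (@le_trans _ _ (f e)); apply: IH => //; try exact: ltW.
    move=> t /andP[ta te] tE; apply: df; first by rewrite ta (lt_trans te eb).
    by rewrite inE negb_or tE andbT lt_eqF.
  move=> t /andP[ta te] tE; apply: df; first by rewrite (lt_trans ae ta) te.
  by rewrite inE negb_or tE andbT gt_eqF.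
apply: IH => // t tab tE; apply: df => //; rewrite inE negb_or tE andbT.
by apply: contraNneq ne => <-.
Qed.

Lemma const_except (E : seq R) f a b : a <= b -> {within `[a, b], continuous f} ->
  (forall t, a < t < b -> t \notin E -> is_derive t 1 f 0) -> f a = f b.
Proof.
move=> ab cf df; apply/eqP; rewrite eq_le; apply/andP; split.
  by apply: (mono_except ab cf (E := E)) => t tab tE; exists 0 => //; exact: df.
rewrite -lerN2; apply: (@mono_except E (fun x => - f x)) => //.
  by move=> x; apply: cvgN; exact: cf.
move=> t tab tE; exists (- 0); last by rewrite oppr0.
by apply: is_derive_opp; exact: df.
Qed.

End Integrals.

(** * Oriented area over one cell *)

Section CellArea.
Context {R : realType}.
Implicit Types (a b t c : R).
Local Notation mu := (@lebesgue_measure R).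

(** The boundary term of the integration by parts at angle [t], for a support
    value [x] and a slope [m]. *)
Definition potential (p : R * R) (x m t : R) :=
  x * m + det2 p (x *: nvec t + m *: tvec t).

(** The envelope of the lines with normal [nvec t] and offset [q t] from [p]. *)
Definition front (q : R -> R) (p : R * R) t : R * R :=
  p + q t *: nvec t + derive1 q t *: tvec t.

Section Piece.
Context {q g g1 g2 : R -> R} {a b : R}.
Hypotheses (ab : a < b) (gC : forall t, a <= t <= b -> C2at g g1 g2 t)
  (qg : forall t, a <= t <= b -> q t = g t).

Lemma piece_near t : a < t < b -> \forall u \near t, q u = g u.
Proof.
move=> tab; have : nbhs t `]a, b[%classic by apply: near_in_itvoo; rewrite in_itv.
apply: filterS => u; rewrite /= in_itv /= => /andP[ua ub].
by apply: qg; rewrite !ltW.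
Qed.

Lemma piece_derive t : a < t < b -> is_derive t 1 q (g1 t).
Proof.
move=> tab; have [|dg _ _] := gC (t := t); first by case/andP: tab => *; rewrite !ltW.
apply: near_eq_is_derive dg.
by apply: filterS (piece_near tab) => u ->.
Qed.

Lemma piece_derive1 t : a < t < b -> derive1 q t = g1 t.
Proof. by move=> /piece_derive /derive1_val. Qed.

Lemma piece_derive1_near t : a < t < b -> \forall u \near t, derive1 q u = g1 u.
Proof.
move=> tab; have : nbhs t `]a, b[%classic by apply: near_in_itvoo; rewrite in_itv.
by apply: filterS => u; rewrite /= in_itv /=; exact: piece_derive1.
Qed.

Context (p : R * R).

Lemma front_derive t : a < t < b ->
  derive1 (fst \o front q p) t = - (g t + g2 t) * sin t /\
  derive1 (snd \o front q p) t = (g t + g2 t) * cos t.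
Proof.
move=> tab; have [|dg dg1 cg2] := gC (t := t); first by case/andP: tab => *; rewrite !ltW.
have ds := is_derive_sin t; have dc := is_derive_cos t.
split; apply: derive1_val.
  have H : is_derive t 1 (fun u => p.1 + (g u * cos u - g1 u * sin u))
    (0 + ((g1 t * cos t + g t * - sin t) - (g2 t * sin t + g1 t * cos t))).
    exact: is_derive_add (is_derive_const _ _)
      (is_derive_add (is_derive_mul dg dc) (is_derive_opp (is_derive_mul dg1 ds))).
  have -> : - (g t + g2 t) * sin t =
    0 + ((g1 t * cos t + g t * - sin t) - (g2 t * sin t + g1 t * cos t)) by ring.
  apply: near_eq_is_derive H.
  near=> u; rewrite /front /= /GRing.scale /=.
  have -> : q u = g u by near: u; exact: piece_near.
  have -> : derive1 q u = g1 u by near: u; exact: piece_derive1_near.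
  by ring.
have H : is_derive t 1 (fun u => p.2 + (g u * sin u + g1 u * cos u))
    (0 + ((g1 t * sin t + g t * cos t) + (g2 t * cos t + g1 t * - sin t))).
  exact: is_derive_add (is_derive_const _ _)
    (is_derive_add (is_derive_mul dg ds) (is_derive_mul dg1 dc)).
have -> : (g t + g2 t) * cos t =
  0 + ((g1 t * sin t + g t * cos t) + (g2 t * cos t + g1 t * - sin t)) by ring.
apply: near_eq_is_derive H.
near=> u; rewrite /front /= /GRing.scale /=.
have -> : q u = g u by near: u; exact: piece_near.
have -> : derive1 q u = g1 u by near: u; exact: piece_derive1_near.
by ring.
Unshelve. all: by end_near. Qed.

Lemma piece_cont t : a <= t <= b ->
  [/\ {for t, continuous g}, {for t, continuous g1} & {for t, continuous g2}].
Proof.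
by move=> /gC [dg dg1 cg2]; split=> //;
  [exact: is_derive_cont dg|exact: is_derive_cont dg1].
Qed.

Lemma energy_cont t : a <= t <= b -> {for t, continuous (fun t => g t * g t - g1 t * g1 t)}.
Proof.
move=> /piece_cont [cg cg1 _].
by apply: continuous_atD; [exact: continuous_atM|apply: continuous_atN;
  exact: continuous_atM].
Qed.

Lemma energy_integral :
  \int[mu]_(t in `]a, b[) ((q t) ^+ 2 - (derive1 q t) ^+ 2) =
  \int[mu]_(t in `]a, b[) (g t * g t - g1 t * g1 t).
Proof.
apply: eq_Rintegral => t; rewrite inE /= in_itv /= => tab.
rewrite piece_derive1 // qg ?expr2 //.
by case/andP: tab => *; rewrite !ltW.
Qed.

(** The integrand is [(det2 p tau + q) (q + q'')].  It differs from
    [q ^ 2 - q' ^ 2] by the derivative of the potential. *)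
Lemma cell_area : arc_area (front q p) a b =
  2^-1 * (\int[mu]_(t in `]a, b[) ((q t) ^+ 2 - (derive1 q t) ^+ 2) +
    (potential p (g b) (g1 b) b - potential p (g a) (g1 a) a)).
Proof.
rewrite /arc_area; congr (_ * _).
pose h t := (p.1 * cos t + p.2 * sin t + g t) * (g t + g2 t).
have -> : \int[mu]_(t in `]a, b[) ((front q p t).1 * derive1 (snd \o front q p) t -
    (front q p t).2 * derive1 (fst \o front q p) t) = \int[mu]_(t in `]a, b[) h t.
  apply: eq_Rintegral => t; rewrite inE /= in_itv /= => tab.
  have [-> ->] := front_derive tab; rewrite /front /= /GRing.scale /=.
  rewrite piece_derive1 // qg; last by case/andP: tab => *; rewrite !ltW.
  have cs : cos t * cos t + sin t * sin t = 1 by rewrite -!expr2 cos2Dsin2.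
  transitivity ((g t + g2 t) * (p.1 * cos t + p.2 * sin t +
     g t * (cos t * cos t + sin t * sin t))); first by ring.
  by rewrite cs /h; ring.
have [H [cH dH]] := exists_primitive ab energy_cont.
have cP : {within `[a, b], continuous (fun t => potential p (g t) (g1 t) t)}.
  apply: within_of_pointwise => t /piece_cont [cg cg1 _].
  have cs := @continuous_sin R t; have cc := @continuous_cos R t.
  have cst (x : R) : {for t, continuous (fun _ : R => x)} by exact: cvg_cst.
  rewrite /potential /nvec /tvec; coords.
  apply: continuous_atD; first exact: continuous_atM.
  apply: continuous_atD; last apply: continuous_atN; apply: continuous_atM => //;
    apply: continuous_atD; apply: continuous_atM => //; exact: continuous_atN.
rewrite energy_integral (FTC_open ab energy_cont cH dH).
have ch t : a <= t <= b -> {for t, continuous h}.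
  move=> /piece_cont [cg cg1 cg2].
  have cs := @continuous_sin R t; have cc := @continuous_cos R t.
  have cst (x : R) : {for t, continuous (fun _ : R => x)} by exact: cvg_cst.
  apply: continuous_atM; apply: continuous_atD => //.
  by apply: continuous_atD; exact: continuous_atM.
have cHP : {within `[a, b], continuous (fun t => H t + potential p (g t) (g1 t) t)}.
  by move=> t; apply: cvgD; [exact: cH|exact: cP].
suff dHP t : a < t < b -> is_derive t 1 (fun t => H t + potential p (g t) (g1 t) t) (h t).
  by rewrite (FTC_open ab ch cHP dHP); ring.
move=> tab; have [|dg dg1 cg2] := gC (t := t); first by case/andP: tab => *; rewrite !ltW.
have ds := is_derive_sin t; have dc := is_derive_cos t.
pose f1 u := g u * cos u + g1 u * - sin u.
pose f2 u := g u * sin u + g1 u * cos u.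
have d1 : is_derive t 1 f1 ((g1 t * cos t + g t * - sin t) + (g2 t * - sin t
  + g1 t * - cos t)).
  exact: is_derive_add (is_derive_mul dg dc) (is_derive_mul dg1 (is_derive_opp ds)).
have d2 : is_derive t 1 f2 ((g1 t * sin t + g t * cos t) + (g2 t * cos t + g1 t * - sin t)).
  exact: is_derive_add (is_derive_mul dg ds) (is_derive_mul dg1 dc).
have D : is_derive t 1 (fun t => H t + (g t * g1 t + (p.1 * f2 t - p.2 * f1 t))) (
  (g t * g t - g1 t * g1 t) + ((g1 t * g1 t + g t * g2 t) +
   ((0 * f2 t + p.1 * ((g1 t * sin t + g t * cos t) + (g2 t * cos t + g1 t * - sin t))) -
   (0 * f1 t + p.2 * ((g1 t * cos t + g t * - sin t) + (g2 t * - sin t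
     + g1 t * - cos t)))))).
  exact: is_derive_add (dH t tab) (is_derive_add (is_derive_mul dg dg1)
    (is_derive_add (is_derive_mul (is_derive_const _ _) d2)
      (is_derive_opp (is_derive_mul (is_derive_const _ _) d1)))).
have -> : h t = (g t * g t - g1 t * g1 t) + ((g1 t * g1 t + g t * g2 t) +
   ((0 * f2 t + p.1 * ((g1 t * sin t + g t * cos t) + (g2 t * cos t + g1 t * - sin t))) -
   (0 * f1 t + p.2 * ((g1 t * cos t + g t * - sin t) + (g2 t * - sin t
     + g1 t * - cos t))))).
  by rewrite /h; ring.
exact: D.
Qed.

End Piece.
End CellArea.

(** * One-sided derivatives and areas of segments *)

Section OneSided.
Context {R : realType}.
Implicit Types (q g : R -> R) (a b t l : R).

Lemma quotient_cvg g t l : is_derive t 1 g l ->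
  (fun h => h^-1 * (g (t + h) - g t)) @ 0^' --> l.
Proof.
move=> [dg <-]; have -> : (fun h => h^-1 * (g (t + h) - g t)) =
    (fun h => h^-1 *: ((g \o shift t) (h *: 1) - g t)).
  by apply/funext => h; rewrite /= /GRing.scale /= mulr1 addrC [h + t]addrC addrC.
exact: dg.
Qed.

Lemma left_derivative_piece q g a b l : a < b -> (forall t, a <= t <= b -> q t = g t) ->
  is_derive b 1 g l -> left_derivative q b = l.
Proof.
move=> ab qg dg; apply: cvg_lim => //.
apply: cvg_trans (cvg_dnbhs_at_left (quotient_cvg dg)).
apply: near_eq_cvg; near=> h.
have h0 : h < 0 by near: h; exact: nbhs_left_lt.
have ha : a - b < h by near: h; apply: nbhs_left_gt; rewrite subr_lt0.
by rewrite !qg //; apply/andP; split; lra.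
Unshelve. all: by end_near. Qed.

Lemma right_derivative_piece q g a b l : a < b -> (forall t, a <= t <= b -> q t = g t) ->
  is_derive a 1 g l -> right_derivative q a = l.
Proof.
move=> ab qg dg; apply: cvg_lim => //.
apply: cvg_trans (cvg_dnbhs_at_right (quotient_cvg dg)).
apply: near_eq_cvg; near=> h.
have h0 : 0 < h by near: h; exact: nbhs_right_gt.
have ha : h < b - a by near: h; apply: nbhs_right_lt; rewrite subr_gt0.
by rewrite !qg //; apply/andP; split; lra.
Unshelve. all: by end_near. Qed.

Lemma segment_area (A B : R * R) : arc_area (lerp A B) 0 1 = 2^-1 * det2 A B.
Proof.
rewrite /arc_area; congr (_ * _).
have d1 t : derive1 (fst \o lerp A B) t = B.1 - A.1.
  apply: derive1_val.
  have := is_derive_add (is_derive_const A.1 t) (is_derive_mul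
    (is_derive_id t 1) (is_derive_const (B.1 - A.1) t)).
  by rewrite mulr0 addr0 add0r mul1r.
have d2 t : derive1 (snd \o lerp A B) t = B.2 - A.2.
  apply: derive1_val.
  have := is_derive_add (is_derive_const A.2 t) (is_derive_mul
    (is_derive_id t 1) (is_derive_const (B.2 - A.2) t)).
  by rewrite mulr0 addr0 add0r mul1r.
pose D := det2 A B.
have -> : \int[lebesgue_measure]_(t in `]0, 1[) ((lerp A B t).1 * derive1
  (snd \o lerp A B) t -
    (lerp A B t).2 * derive1 (fst \o lerp A B) t) = \int[lebesgue_measure]_(t in `]0, 1[) D.
  have DE (t : R) : (lerp A B t).1 * (B.2 - A.2) - (lerp A B t).2 * (B.1 - A.1) = D.
    by rewrite /D /lerp; coords; ring.
  by apply: eq_Rintegral => t _; rewrite d1 d2; exact: DE.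
have cD (t : R) : 0 <= t <= 1 -> {for t, continuous (fun _ : R => D)} by move=> _;
  exact: cvg_cst.
have dF (t : R) : is_derive t 1 (fun x => x * D) D.
  have := is_derive_mul (is_derive_id t 1) (is_derive_const D t).
  by rewrite mulr0 addr0 mul1r.
have cF : {within `[0, 1], continuous (fun x : R => x * D)}.
  by apply: within_of_pointwise => t _; exact: is_derive_cont (dF t).
by rewrite (FTC_open ltr01 cD cF (fun t _ => dF t)) mul1r mul0r subr0.
Qed.

End OneSided.

(** * The Wirtinger inequality on a cell *)

Lemma avoid_seq {R : realType} (E : seq R) (a b : R) : a < b ->
  exists2 t, a < t < b & t \notin E.
Proof.
elim: E a b => [|e E IH] a b ab.
  by exists ((a + b) / 2) => //; apply/andP; split; lra.
have [/andP[ae eb]|ne] := boolP (a < e < b).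
  have [t /andP[ta te] tE] := IH a e ae; exists t; first by rewrite ta (lt_trans te eb).
  by rewrite inE negb_or tE andbT lt_eqF.
have [t tab tE] := IH a b ab; exists t => //.
by rewrite inE negb_or tE andbT; apply: contraNneq ne => <-.
Qed.

Section Wirtinger.
Context {R : realType}.
Implicit Types (a b t c : R).
Local Notation mu := (@lebesgue_measure R).

Context {q g g1 g2 : R -> R} {a b c : R}.
Hypotheses (ab : a < b) (gC : forall t, a <= t <= b -> C2at g g1 g2 t)
  (qg : forall t, a <= t <= b -> q t = g t)
  (zero : forall t, a <= t <= b -> sin (t - c) = 0 -> q t = 0).

Let s t := sin (t - c).
Let k t := cos (t - c).
(** The value at a zero of the sine is [0], by the convention on inverses; this
    is also the limit there, because [q] vanishes at the same point. *)
Definition cotangent_form t := q t ^+ 2 * cos (t - c) / sin (t - c).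
Let F t := g t * g t * k t / s t.

Let ds t : is_derive t 1 s (k t).
Proof.
have := @is_derive_comp _ sin (fun x =>
  x - c) t _ _ (is_derive_sin (t - c)) (is_derive_add (is_derive_id t 1)
    (is_derive_const (- c) t)).
by rewrite addr0 mulr1.
Qed.

Let dk t : is_derive t 1 k (- s t).
Proof.
have := @is_derive_comp _ cos (fun x =>
  x - c) t _ _ (is_derive_cos (t - c)) (is_derive_add (is_derive_id t 1)
    (is_derive_const (- c) t)).
by rewrite addr0 mulr1.
Qed.

Let sk t : s t * s t + k t * k t = 1.
Proof. by rewrite -!expr2 addrC cos2Dsin2. Qed.

(** At a common zero both [g] and the sine are [t - t0] times continuous
    functions, the second one not vanishing; one factor [t - t0] is left in the
    quotient. *)
Let F_cont t : a <= t <= b -> {for t, continuous F}.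
Proof.
move=> tab; have [dg dg1 cg2] := gC tab.
have cg := is_derive_cont dg; have ck := is_derive_cont (dk t).
have cs := is_derive_cont (ds t).
have [s0|s0] := eqVneq (s t) 0; last first.
  apply: continuous_atM; last exact: cvgV.
  by apply: continuous_atM => //; exact: continuous_atM.
have g0 : g t = 0 by rewrite -qg // zero.
have [u [uE cu _]] := (is_derive1_caratheodory g t (g1 t)).1 dg.
have [v [vE cv vt]] := (is_derive1_caratheodory s t (k t)).1 (ds t).
have v0 : v t != 0.
  rewrite vt; apply/eqP => k0; have := sk t; rewrite s0 k0 !mulr0 addr0 => /eqP.
  by rewrite eq_sym oner_eq0.
(* By Caratheodory, g = u (z - t) and s = v (z - t) near the common zero t. *)
have -> : F = (fun z => u z * u z * (z - t) * k z / v z).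
  apply/funext => z; have := uE z; have := vE z; rewrite g0 s0 !subr0 /F => -> ->.
  have [->|zt] := eqVneq z t; first by rewrite subrr !(mulr0, mul0r).
  have zt' : z - t != 0 by rewrite subr_eq0.
  have [->|vz] := eqVneq (v z) 0; first by rewrite mul0r invr0 !mulr0.
  by field; rewrite zt' vz.
have ci : {for t, continuous (fun z => z - t)} by apply: cvgB;
  [exact: cvg_id|exact: cvg_cst].
apply: continuous_atM; last exact: cvgV.
by apply: continuous_atM => //; apply: continuous_atM => //; exact: continuous_atM.
Qed.

Context {E : seq R} (sE : forall t, a < t < b -> t \notin E -> sin (t - c) != 0).

Lemma cotangent_formE t : a <= t <= b -> cotangent_form t = F t.
Proof. by move=> tab; rewrite /cotangent_form qg // expr2. Qed.

(** The function [- H - F], with [H] a primitive of [g ^ 2 - g1 ^ 2], has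
    derivative [(g1 - g cot) ^ 2] off the zeros of the sine.  In the case of
    equality it is constant, so that [g1 * s = g * k] there.  Then
    [g * s + g1 * k] has zero derivative; it is the factor [A]. *)
Lemma wirtinger_cell :
  \int[mu]_(t in `]a, b[) ((q t) ^+ 2 - (derive1 q t) ^+ 2) <=
    cotangent_form a - cotangent_form b
  /\ (\int[mu]_(t in `]a, b[) ((q t) ^+ 2 - (derive1 q t) ^+ 2) =
    cotangent_form a - cotangent_form b ->
    exists A, forall t, a <= t <= b -> q t = A * sin (t - c)).
Proof.
have aab : a <= a <= b by rewrite lexx ltW.
have bab : a <= b <= b by rewrite lexx ltW.
have oc t : a < t < b -> a <= t <= b by case/andP=> *; rewrite !ltW.
rewrite (energy_integral gC qg) !cotangent_formE //.
have ce := energy_cont gC.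
have [H [cH dH]] := exists_primitive ab ce.
rewrite (FTC_open ab ce cH dH).
pose J t := - H t - F t.
have cF : {within `[a, b], continuous F} by exact: (within_of_pointwise F_cont).
have cJ : {within `[a, b], continuous J}.
  by move=> t; apply: cvgB; [apply: cvgN; exact: cH|exact: cF].
have dJ t : a < t < b -> s t != 0 -> is_derive t 1 J ((g1 t - g t * k t / s t) ^+ 2).
  move=> tab s0; have [dg dg1 cg2] := gC (oc t tab).
  have dF := is_derive_mul (is_derive_mul (is_derive_mul dg dg) (dk t))
    (is_derive_inv s0 (ds t)).
  have D := is_derive_add (is_derive_opp (dH t tab)) (is_derive_opp dF).
  apply: (@is_derive_eq _ _ _ _ _ _ _ _ D).
  by field.
have mono x y : a <= x -> x <= y -> y <= b -> J x <= J y.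
  move=> ax xy yb; apply: (mono_except xy (E := E)).
    by apply: continuous_subspaceW cJ; apply: subset_itv; rewrite bnd_simp.
  move=> t /andP[xt ty] tE; have tab : a < t < b.
    by rewrite (le_lt_trans ax xt) (lt_le_trans ty yb).
  by exists ((g1 t - g t * k t / s t) ^+ 2); [exact: dJ (sE tab tE)|exact: sqr_ge0].
have Jab : J a <= J b by apply: mono => //; exact: ltW.
split; first by move: Jab; rewrite /J; lra.
move=> eqI; have JE : J a = J b by move: eqI; rewrite /J; lra.
have rel t : a < t < b -> s t != 0 -> g1 t * s t = g t * k t.
  move=> tab s0; have D := dJ t tab s0.
  have : is_derive t 1 J 0.
    apply: near_eq_is_derive (is_derive_const (J a) t).
    have : nbhs t `]a, b[%classic by apply: near_in_itvoo; rewrite in_itv.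
    apply: filterS => u; rewrite /= in_itv /= => /andP[ua ub].
    by apply/eqP; rewrite eq_le {2}JE !mono // ltW.
  move=> /derive1_val J0; have := derive1_val D; rewrite J0 => /esym/eqP.
  by rewrite sqrf_eq0 subr_eq0 => /eqP ->; rewrite divfK.
pose al t := g t * s t + g1 t * k t.
have dal t : a <= t <= b -> is_derive t 1 al ((g t + g2 t) * k t).
  move=> tab; have [dg dg1 cg2] := gC tab.
  have D := is_derive_add (is_derive_mul dg (ds t)) (is_derive_mul dg1 (dk t)).
  by apply: (@is_derive_eq _ _ _ _ _ _ _ _ D); ring.
have cal : {within `[a, b], continuous al}.
  by apply: within_of_pointwise => t tab; exact: is_derive_cont (dal t tab).
have g20 u : a < u < b -> s u != 0 -> g u + g2 u = 0.
  move=> uab s0; have [dg dg1 cg2] := gC (oc u uab).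
  have D1 := is_derive_mul dg1 (ds u); have D2 := is_derive_mul dg (dk u).
  have near_eq : \forall z \near u, g1 z * s z = g z * k z.
    have n1 : nbhs u `]a, b[%classic by apply: near_in_itvoo; rewrite in_itv.
    have cs := is_derive_cont (ds u).
    have n2 : \forall z \near u, s z != 0 by exact: (cvgr_neq0 _ cs s0).
    by apply: filterS2 n1 n2 => z; rewrite /= in_itv /= => zab z0; exact: rel.
  have e1 := derive1_val (near_eq_is_derive near_eq D1).
  rewrite (derive1_val D2) in e1.
  have : (g u + g2 u) * s u = 0 by move: e1; lra.
  by move/eqP; rewrite mulf_eq0 (negbTE s0) orbF => /eqP.
have alconst t : a <= t <= b -> al t = al a.
  move=> /andP[ta tb]; symmetry; apply: (const_except ta (E := E)).
    by apply: continuous_subspaceW cal; apply: subset_itvl; rewrite bnd_simp.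
  move=> u /andP[au ut] uE; have uab : a < u < b by rewrite au (lt_le_trans ut tb).
  by have := dal u (oc u uab); rewrite (g20 u uab (sE uab uE)) mul0r.
pose r t := g1 t * s t - g t * k t.
have dr t : a <= t <= b -> is_derive t 1 r ((g t + g2 t) * s t).
  move=> tab; have [dg dg1 cg2] := gC tab.
  have D := is_derive_add (is_derive_mul dg1 (ds t)) (is_derive_opp
    (is_derive_mul dg (dk t))).
  by apply: (@is_derive_eq _ _ _ _ _ _ _ _ D); ring.
have cr : {within `[a, b], continuous r}.
  by apply: within_of_pointwise => t tab; exact: is_derive_cont (dr t tab).
have rconst t : a <= t <= b -> r t = r a.
  move=> /andP[ta tb]; symmetry; apply: (const_except ta (E := E)).
    by apply: continuous_subspaceW cr; apply: subset_itvl; rewrite bnd_simp.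
  move=> u /andP[au ut] uE; have uab : a < u < b by rewrite au (lt_le_trans ut tb).
  by have := dr u (oc u uab); rewrite (g20 u uab (sE uab uE)) mul0r.
have [t0 t0ab t0E] := avoid_seq E ab.
have r0 : r a = 0.
  by rewrite -(rconst t0 (oc t0 t0ab)) /r rel ?subrr //; exact: sE.
exists (al a) => t tab; rewrite qg // -/(s t) -(alconst t tab).
have rt : g1 t * s t = g t * k t.
  by apply/eqP; rewrite -subr_eq0; apply/eqP; rewrite -r0 -(rconst t tab).
rewrite /al mulrDl -[g1 t * k t * s t]mulrA [k t * s t]mulrC mulrA rt.
by rewrite -[LHS]mulr1 -(sk t); ring.
Qed.

End Wirtinger.

(** * Summation over a period *)

Section Front.
Context {R : realType} {q : R -> R} (p : R * R).
Implicit Types (a b c t l r : R).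
Local Notation mu := (@lebesgue_measure R).
Local Notation ld := (left_derivative q).
Local Notation rd := (right_derivative q).
Local Notation pot := (potential p).

(** The one-sided limit of the envelope at [t] when the one-sided derivative
    is [l]. *)
Definition corner t l : R * R := p + q t *: nvec t + l *: tvec t.
Definition cell_energy a b := \int[mu]_(t in `]a, b[) ((q t) ^+ 2 - (derive1 q t) ^+ 2).

(** The area swept by an inserted segment is the jump of the potential. *)
Lemma corner_area t l r : arc_area (lerp (corner t l) (corner t r)) 0 1 =
  2^-1 * (pot (q t) r t - pot (q t) l t).
Proof.
rewrite segment_area; congr (_ * _); rewrite /corner /potential /nvec /tvec; coords.
have cs : cos t * cos t + sin t * sin t = 1 by rewrite -!expr2 cos2Dsin2.
transitivity ((r - l) * (p.1 * cos t + p.2 * sin t + q t * (cos t * cos t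
  + sin t * sin t))).
  by ring.
by rewrite cs; ring.
Qed.

(** The formula [g] is required on the closed interval, so that [q] has one-sided
    derivatives at its ends. *)
Definition piece a b := exists g g1 g2,
  (forall t, a <= t <= b -> C2at g g1 g2 t) /\ (forall t, a <= t <= b -> q t = g t).

Lemma piece_area a b : a < b -> piece a b ->
  arc_area (front q p) a b =
  2^-1 * (cell_energy a b + (pot (q b) (ld b) b - pot (q a) (rd a) a)).
Proof.
move=> ab [g [g1 [g2 [gC qg]]]].
have aab : a <= a <= b by rewrite lexx ltW.
have bab : a <= b <= b by rewrite lexx ltW.
have [da _ _] := gC a aab; have [db _ _] := gC b bab.
rewrite (cell_area ab gC qg) (left_derivative_piece ab qg db).
by rewrite (right_derivative_piece ab qg da) !qg.
Qed.

Hypothesis qpi : forall t, q (t + pi) = - q t.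
Context {m : nat} {d : nat -> R} (m0 : (0 < m)%N) (d0 : d 0%N = 0) (dm : d m = pi)
  (dlt : forall k, (k < m)%N -> d k < d k.+1)
  (dpiece : forall k, (k < m)%N -> piece (d k) (d k.+1)).

Lemma break_lt i j : (i < j <= m)%N -> d i < d j.
Proof.
elim: j => // j IH /andP[ij jm]; have [ij'|ji] := ltnP i j.
  by apply: lt_trans (dlt jm); apply: IH; rewrite ij' ltnW.
by have -> : i = j; [apply/eqP; rewrite eqn_leq ji andbT|exact: dlt].
Qed.

Lemma break_le i j : (i <= j <= m)%N -> d i <= d j.
Proof.
move=> /andP[ij jm]; have [->//|ne] := eqVneq i j.
by apply/ltW/break_lt; rewrite jm andbT ltn_neqAle ne.
Qed.

Lemma break_itv i : (i <= m)%N -> 0 <= d i <= pi.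
Proof. by move=> im; rewrite -d0 -dm !break_le // im ?leqnn ?andbT. Qed.

Lemma break_locate t : 0 <= t <= pi -> exists k, (k < m)%N /\ d k <= t <= d k.+1.
Proof.
move=> /andP[t0 tp].
have H j : (j <= m)%N -> t <= d j -> (0 < j)%N -> exists k, (k < m)%N /\ d k <= t <= d k.+1.
  elim: j => // j IH jm tj _; have [jt|tj'] := leP (d j) t.
    by exists j; rewrite jm jt tj.
  have [j0|j0] := posnP j; last by apply: IH => //; [exact: ltnW|exact: ltW].
  by move: tj'; rewrite j0 d0 ltNge t0.
by apply: (H m) => //; rewrite dm.
Qed.

Lemma left_derivative0 : ld 0 = - ld pi.
Proof.
have mm : (m.-1 < m)%N by rewrite ltn_predL.
have [g [g1 [g2 [gC qg]]]] := dpiece mm.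
have mE : d m.-1.+1 = pi by rewrite prednK.
have ab := dlt mm; rewrite mE in gC qg ab.
have bab : d m.-1 <= (pi : R) <= (pi : R) by apply/andP; split; [exact: ltW|].
have [db _ _] := gC pi bab.
rewrite (left_derivative_piece ab qg db).
have ds : is_derive (0 : R) (1 : R) (fun t : R => t + pi) (1 : R).
  by have := is_derive_add (is_derive_id (0 : R) 1) (is_derive_const (pi : R) 0);
    rewrite addr0.
have dg : is_derive (0 + pi : R) (1 : R) g (g1 pi) by rewrite add0r.
(* To the left of 0 the support function is the last piece, shifted and negated. *)
have dq : is_derive (0 : R) (1 : R) (fun t => - g (t + pi)) (- g1 pi).
  have := is_derive_opp (@is_derive_comp _ g (fun t => t + pi) 0 _ _ dg ds).
  by rewrite mulr1.
apply: (@left_derivative_piece _ _ _ (d m.-1 - pi) _ _ _ _ dq);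
  first by rewrite subr_lt0; exact: ab.
by move=> t /andP[ta tb]; rewrite -qg ?qpi ?opprK //; apply/andP; split; lra.
Qed.

Lemma potentialDpi x l t : pot (- x) (- l) (t + pi) = pot x l t.
Proof. by rewrite /potential /nvec /tvec cosDpi sinDpi; coords; ring. Qed.

(** The potentials telescope: each break point occurs as the end of a cell, as
    an inserted segment and as the start of the next cell, and the values at [0]
    and [pi] agree by antiperiodicity. *)
Lemma front_area :
  \sum_(0 <= k < m) arc_area (front q p) (d k) (d k.+1) +
  \sum_(0 <= k < m) arc_area (lerp (corner (d k) (ld (d k))) (corner (d k) (rd
    (d k)))) 0 1 =
  2^-1 * \sum_(0 <= k < m) cell_energy (d k) (d k.+1).
Proof.
pose f k := pot (q (d k)) (ld (d k)) (d k).
have fE : f m = f 0%N.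
  rewrite /f dm d0 -(potentialDpi _ (ld 0)) add0r left_derivative0 opprK.
  by have := qpi 0; rewrite add0r => ->.
have tel := telescope_sumr f (leq0n m); rewrite fE subrr in tel.
rewrite -big_split /= mulr_sumr.
transitivity (\sum_(0 <= k < m) (2^-1 * cell_energy (d k) (d k.+1)
  + 2^-1 * (f k.+1 - f k))).
  apply: eq_big_nat => k /andP[_ km].
  rewrite (piece_area (dlt km) (dpiece km)) corner_area /f; ring.
by rewrite big_split /= -[X in _ + X]mulr_sumr tel mulr0 addr0.
Qed.

(** Antiperiodicity gives [q pi = - q 0], so the sign of [q] changes on some
    piece. *)
Lemma support_zero : exists2 c, 0 <= c <= pi & q c = 0.
Proof.
apply: contrapT => nz.
have {}nz t : 0 <= t <= pi -> q t != 0.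
  by move=> tp; apply/eqP => q0; apply: nz; exists t.
have p0 : 0 <= (0 : R) <= pi by rewrite lexx pi_ge0.
have q00 := nz 0 p0.
have pos k : (k <= m)%N -> 0 < q 0 * q (d k).
  elim: k => [_|k IH km].
    by rewrite d0 -expr2 exprn_even_gt0.
  have {}IH := IH (ltnW km); rewrite ltNge; apply/negP => le0.
  have [g [g1 [g2 [gC qg]]]] := dpiece km.
  have ab := dlt km.
  have aab : d k <= d k <= d k.+1 by rewrite lexx ltW.
  have bab : d k <= d k.+1 <= d k.+1 by rewrite lexx ltW.
  have cf : {within `[d k, d k.+1], continuous (fun t => q 0 * g t)}.
    apply: within_of_pointwise => t /gC [dg _ _].
    by apply: continuous_atM; [exact: cvg_cst|exact: is_derive_cont dg].
  have [|t] := @IVT _ (fun t => q 0 * g t) _ _ 0 (ltW ab) cf.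
    by rewrite -!qg // ge_min le_max le0 orbT /= (ltW IH).
  rewrite in_itv /= => tab /eqP; rewrite mulf_eq0 (negbTE q00) /= -qg //.
  apply/negP/nz; have := break_itv (ltnW km); have := break_itv km.
  case/andP: tab => h1 h2 /andP[h3 h4] /andP[h5 h6].
  by rewrite (le_trans h5 h1) (le_trans h2 h4).
have := pos m (leqnn m); rewrite dm -[pi]add0r qpi mulrN oppr_gt0.
by rewrite ltNge -expr2 sqr_ge0.
Qed.

Section SineComparison.
Context {c : R} (c01 : 0 <= c <= pi) (qc : q c = 0).

Lemma sine_zero t : 0 <= t <= pi -> sin (t - c) = 0 -> q t = 0.
Proof.
move=> /andP[t0 tp] s0; have /andP[c0 cp] := c01.
have [tc|tc] := leP pi (t - c).
  have -> : t = 0 + pi by lra.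
  have cz : c = 0 by lra.
  by move: qc; rewrite cz qpi => ->; rewrite oppr0.
have [tc'|tc'] := leP (t - c) (- pi).
  have cE : c = 0 + pi by lra.
  have -> : t = 0 by lra.
  by apply/eqP; rewrite -oppr_eq0 -qpi -cE qc.
have /sin_eq0_small : - pi < t - c < pi by rewrite tc'.
by move=> /(_ s0) /eqP; rewrite subr_eq0 => /eqP ->.
Qed.

Lemma sine_neq0 t : 0 < t < pi -> t \notin [:: c] -> sin (t - c) != 0.
Proof.
move=> /andP[t0 tp]; have /andP[c0 cp] := c01; rewrite inE; apply: contra => /eqP s0.
have : - pi < t - c < pi by apply/andP; split; lra.
by move=> /sin_eq0_small /(_ s0) /eqP; rewrite subr_eq0.
Qed.

Local Notation cf := (@cotangent_form R q c).

(** On a period the sine of [t - c] vanishes only at [c], where [q] vanishes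
    too, and possibly at the two ends. *)
Lemma cell_bound k : (k < m)%N ->
  cell_energy (d k) (d k.+1) <= cf (d k) - cf (d k.+1) /\
  (cell_energy (d k) (d k.+1) = cf (d k) - cf (d k.+1) ->
   exists A, forall t, d k <= t <= d k.+1 -> q t = A * sin (t - c)).
Proof.
move=> km; have [g [g1 [g2 [gC qg]]]] := dpiece km.
have /andP[h1 h2] := break_itv (ltnW km); have /andP[h3 h4] := break_itv km.
have zero t : d k <= t <= d k.+1 -> sin (t - c) = 0 -> q t = 0.
  by move=> /andP[ta tb]; apply: sine_zero; rewrite (le_trans h1 ta) (le_trans tb h4).
have sE t : d k < t < d k.+1 -> t \notin [:: c] -> sin (t - c) != 0.
  by move=> /andP[ta tb]; apply: sine_neq0; rewrite (le_lt_trans h1 ta) (lt_le_trans tb h4).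
by have := wirtinger_cell (dlt km) gC qg zero sE.
Qed.

Lemma cotangent_period : cf pi = cf 0.
Proof.
have q0 : q pi = - q 0 by rewrite -qpi add0r.
rewrite /cotangent_form q0 sqrrN sub0r cosN sinN.
have -> : pi - c = - c + pi by rewrite addrC.
by rewrite cosDpi sinDpi cosN sinN opprK invrN !mulrN mulNr.
Qed.

Lemma cotangent_telescope : \sum_(0 <= k < m) (cf (d k) - cf (d k.+1)) = 0.
Proof.
have := telescope_sumr (fun k => cf (d k)) (leq0n m).
rewrite dm d0 cotangent_period subrr => tel; apply/eqP; rewrite -oppr_eq0 -sumrN.
by apply/eqP; rewrite -[RHS]tel; apply: eq_bigr => k _; rewrite opprB.
Qed.

Lemma energy_le0 : \sum_(0 <= k < m) cell_energy (d k) (d k.+1) <= 0.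
Proof.
rewrite -[leRHS]cotangent_telescope !big_mkord; apply: ler_sum => k _.
by have [] := cell_bound (ltn_ord k).
Qed.

(** Each of the inequalities of [cell_bound] is an equality.  Two neighbouring
    cells have the same factor unless they meet at [c].  If [c] is a break point
    inside the period, the cells before and after it are related through
    [q pi = - q 0]. *)
Lemma energy_eq0 : \sum_(0 <= k < m) cell_energy (d k) (d k.+1) = 0 ->
  exists A, forall t, 0 <= t <= pi -> q t = A * sin (t - c).
Proof.
move=> E0.
have cellE k : exists A, (k < m)%N -> forall t, d k <= t <= d k.+1 -> q t = A * sin (t - c).
  have [km|] := boolP (k < m)%N; last by exists 0.
  have [_] := cell_bound km; case=> [|A AE]; last by exists A.
  have S0 : \sum_(i < m) (cf (d i) - cf (d i.+1) - cell_energy (d i) (d i.+1)) = 0.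
    have := cotangent_telescope; rewrite !big_mkord in E0 * => t0.
    by rewrite sumrB t0 E0 subrr.
  have nn (i : 'I_m) : true -> 0 <= cf (d i) - cf (d i.+1) - cell_energy (d i) (d i.+1).
    by move=> _; rewrite subr_ge0; have [] := cell_bound (ltn_ord i).
  have := psumr_eq0P nn S0 (i := Ordinal km) isT => /= H.
  by apply/esym/eqP; rewrite -subr_eq0 H.
have [A AE] := choice cellE.
have step k : (k.+1 < m)%N -> sin (d k.+1 - c) != 0 -> A k.+1 = A k.
  move=> km s0; apply: (mulIf s0).
  rewrite -(AE k.+1 km) ?lexx ?(ltW (dlt km)) //.
  by rewrite -(AE k (ltnW km)) ?lexx ?(ltW (dlt (ltnW km))).
have glue k j : (k + j < m)%N -> (forall i, (k < i <= k + j)%N -> sin (d i - c) != 0) ->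
    A (k + j)%N = A k.
  elim: j => [|j IH]; first by rewrite addn0.
  rewrite addnS => kj ne; rewrite step //; last by apply: ne; lia.
  by apply: IH => [|i ij]; [exact: ltnW|apply: ne; lia].
have inner i : (0 < i < m)%N -> 0 < d i < pi.
  by move=> im; rewrite -{1}d0 -dm !break_lt //; lia.
have all0 k : (k < m)%N -> A k = A 0%N.
  move=> km; have [ne|] := pselect (forall i, (0 < i <= k)%N -> sin (d i - c) != 0).
    by rewrite -(glue 0%N k).
  move=> /existsNP [i /not_implyP [ik /negP]]; rewrite negbK => /eqP s0.
  have im : (0 < i < m)%N by lia.
  have /andP[di0 dip] := inner i im.
  have dic : d i = c.
    apply: contrapT => /eqP ne; have := @sine_neq0 (d i).
    by rewrite di0 dip inE s0 eqxx => /(_ isT ne).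
  have last : A m.-1 = A k.
    have mE : m.-1 = (k + (m.-1 - k))%N by lia.
    rewrite mE; apply: glue => [|j kj]; first by lia.
    apply: sine_neq0; first by apply: inner; lia.
    by rewrite inE -dic gt_eqF // break_lt; lia.
  rewrite -last; have sc : 0 < sin c by apply: sin_gt0_pi; rewrite -dic di0.
  apply: (mulIf (lt0r_neq0 sc)).
  have q0 : q 0 = A 0%N * sin (0 - c).
    by apply: (AE 0%N m0); rewrite -d0 lexx ltW // dlt.
  have mm : (m.-1 < m)%N by lia.
  have qp : q pi = A m.-1 * sin (pi - c).
    have mE : m.-1.+1 = m by lia.
    by apply: (AE m.-1 mm); rewrite mE dm lexx andbT -dm -mE ltW // dlt.
  have := qpi 0; rewrite add0r qp q0 sub0r sinN.
  have -> : pi - c = - c + pi by rewrite addrC.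
  by rewrite sinDpi sinN; lra.
exists (A 0%N) => t /break_locate [k [km tk]].
by rewrite (AE k km t tk) all0.
Qed.

End SineComparison.
End Front.

(** * Smoothness of the support function and break points *)

Section Support.
Context {R : realType} {n : nat} {P : nat -> R * R} (HP : cppos n P).
Context {p : R * R} (hp : forall k, 0 < height P k p).
Implicit Types (i j k : nat) (a b t : R).
Local Notation q := (qfun n P p).
Local Notation cell_set := (@cell_set R n P p).
Local Notation ld := (left_derivative q).
Local Notation rd := (right_derivative q).

Ltac smooth := repeat first [ apply: C2on_cst | apply: C2on_cos | apply: C2on_sin
  | apply: C2on_opp | apply: C2on_add | apply: C2on_mul ].

(** A positive discriminant gives a smooth square root and, when the equation
    is linear, a nonvanishing denominator. *)
Lemma quad_root_C2 i j : C2on [set t | 0 < @quad_disc R n P p i j t]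
  (@quad_root R n P p i j).
Proof.
set A := [set t | _].
have C1s : C2on A (@quad1 R n P p i j).
  by rewrite /quad1 /cleared /nvec; coords; smooth.
have C0s : C2on A (@quad0 R n P p i j).
  by rewrite /quad0 /cleared /nvec; coords; smooth.
have Ds : C2on A (@quad_disc R n P p i j).
  by rewrite /quad_disc; smooth.
rewrite /quad_root; have [C20|C20] := eqVneq (@quad2 R P i j) 0.
  apply: C2on_mul; first exact: C2on_opp.
  apply: C2on_inv => // t; rewrite /A /= /quad_disc C20 mulr0 subr0.
  by apply: contraTneq => ->; rewrite mulr0 ltxx.
apply: C2on_mul; last exact: C2on_cst.
by apply: C2on_add; [exact: C2on_opp|apply: C2on_sqrt].
Qed.

Lemma cell_piece i j a b : (forall t, a <= t <= b -> cell_set i j t) -> @piece R q a b.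
Proof.
move=> cell; have [g1 [g2 gC]] := quad_root_C2 i j.
by exists (@quad_root R n P p i j), g1, g2;
  split=> t /cell /(quad_rootE HP hp) [dt E] //; exact: gC.
Qed.

(** Near such an angle a single formula describes [q], on both sides. *)
Lemma nontransition_smooth t : ~ transition n P p t -> ld t = rd t.
Proof.
move=> /(nontransition_near HP hp) [i [j /nbhs_ballP [e /= e0 be]]].
have cell u : t - e / 2 <= u <= t + e / 2 -> cell_set i j u.
  by move=> ue; apply: be; rewrite /ball /= ltr_distlC; apply/andP; split; lra.
have [g [g1 [g2 [gC qg]]]] := cell_piece cell.
have [|dt _ _] := gC t; first by apply/andP; split; lra.
rewrite (@left_derivative_piece _ q g (t - e / 2) t _ _ _ dt); last first.
- by move=> u uI; apply: qg; lra.
- lra.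
rewrite (@right_derivative_piece _ q g t (t + e / 2) _ _ _ dt) //.
- lra.
- by move=> u uI; apply: qg; lra.
Qed.

(** The transitions of a period, together with its two ends, in increasing
    order. *)
Lemma breakpoints : exists (m : nat) (d : nat -> R),
  [/\ (0 < m)%N, d 0%N = 0, d m = pi, (forall k, (k < m)%N -> d k < d k.+1) &
   [/\ (forall k, (0 < k < m)%N -> transition n P p (d k)),
    (forall k t, (k < m)%N -> d k < t < d k.+1 -> ~ transition n P p t) &
    (forall t, transitions n P p t -> exists2 k, (k < m)%N & t = d k)]].
Proof.
have [s sE] := (finite_seqP _).1 (transitions_finite HP hp).
have sP t : t \in s <-> transition n P p t /\ 0 <= t < pi.
  have : [set` s] t <-> (transition n P p `&` `[0, pi[%classic) t by rewrite sE.
  by rewrite /= in_itv.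
pose l := sort <=%R (undup [:: 0, pi & s]).
have lP t : t \in l <-> [\/ t = 0, t = pi | transition n P p t /\ 0 <= t < pi].
  rewrite mem_sort mem_undup !inE; split.
    by case/or3P => [/eqP|/eqP|/sP]; [constructor 1|constructor 2|constructor 3].
  by case=> [->|->|/sP ->]; rewrite ?eqxx ?orbT.
have l_itv t : t \in l -> 0 <= t <= pi.
  by move=> /lP [->|->|[_ /andP[-> /ltW ->]]]; rewrite ?lexx ?pi_ge0.
have lsort : sorted <%R l by rewrite sort_lt_sorted undup_uniq.
have lmono i j : (i < size l)%N -> (j < size l)%N -> (i < j)%N -> nth 0 l i < nth 0 l j.
  by move=> si sj; exact: (sorted_ltn_nth (@lt_trans _ R)).
have lmonoW i j : (i <= j)%N -> (j < size l)%N -> nth 0 l i <= nth 0 l j.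
  move=> ij sj; have [->//|ne] := eqVneq i j.
  by apply/ltW/lmono => //; [exact: leq_ltn_trans sj|rewrite ltn_neqAle ne].
have m0l : 0 \in l by apply/lP; constructor 1.
have mpl : pi \in l by apply/lP; constructor 2.
have il : (index pi l < size l)%N by rewrite index_mem.
have d0 : nth 0 l 0 = 0.
  apply/eqP; rewrite eq_le; apply/andP; split; last first.
    by have /l_itv/andP[] := mem_nth 0 (leq_ltn_trans (leq0n _) il).
  rewrite -[leRHS](nth_index 0 m0l); apply: lmonoW => //.
  by rewrite index_mem.
have lastE : (index pi l <= (size l).-1)%N by rewrite -ltnS prednK // (leq_ltn_trans _ il).
have lt_last : ((size l).-1 < size l)%N by rewrite prednK // (leq_ltn_trans _ il).
have dm : nth 0 l (size l).-1 = pi.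
  apply/eqP; rewrite eq_le; apply/andP; split.
    by have /l_itv/andP[] := mem_nth 0 lt_last.
  by rewrite -[leLHS](nth_index 0 mpl); exact: lmonoW.
exists (size l).-1, (nth 0 l).
have m0 : (0 < (size l).-1)%N.
  rewrite lt0n; apply/eqP => E; move: dm; rewrite E d0 => /esym pi0.
  by have := @pi_gt0 R; rewrite pi0 ltxx.
have km k : (k < (size l).-1)%N -> (k.+1 < size l)%N by move: lt_last; lia.
split=> //; first by move=> k /km kl; apply: lmono => //; exact: ltnW.
split.
- move=> k /andP[k0 /km kl]; have kl' := ltnW kl.
  have := mem_nth 0 kl' => /lP [E|E|[]//].
    by have := lmono 0%N k (leq_ltn_trans (leq0n _) kl) kl' k0; rewrite d0 E ltxx.
  suff : nth 0 l k < nth 0 l (size l).-1 by rewrite dm E ltxx.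
  by apply: lmono => //; move: kl; lia.
- move=> k t /km kl /andP[kt tk] tr.
  have /l_itv /andP[k0 _] := mem_nth 0 (ltnW kl).
  have /l_itv /andP[_ kp] := mem_nth 0 kl.
  have tl : t \in l.
    apply/lP; constructor 3; split=> //; apply/andP; split.
      exact: ltW (le_lt_trans k0 kt).
    exact: lt_le_trans tk kp.
  move: kt tk; rewrite -(nth_index 0 tl); set i := index t l.
  have ils : (i < size l)%N by rewrite index_mem.
  move=> ki ik; have [h|h] := leqP i k.
    by move: ki; rewrite ltNge lmonoW // ltnW.
  by move: ik; rewrite ltNge lmonoW.
move=> t [tr]; rewrite /= in_itv /= => tp.
have tl : t \in l by apply/lP; constructor 3.
exists (index t l); last by rewrite nth_index.
have tsz : (index t l < size l)%N by rewrite index_mem.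
suff : index t l <> (size l).-1.
  by move: tsz; move: (index t l) (size l) => x y; lia.
move=> E; have := nth_index 0 tl; rewrite E dm => Ep.
by case/andP: tp; rewrite -Ep ltxx.
Qed.

End Support.

(** * The oriented area of the completed front *)

Lemma arc_area_const {R : realType} (f : R -> R * R) (a b : R) z :
  (forall t, a < t < b -> f t = z) -> arc_area f a b = 0.
Proof.
move=> fz; rewrite /arc_area.
have nearz t : a < t < b -> \forall u \near t, z = f u.
  move=> tab; have : nbhs t `]a, b[%classic by apply: near_in_itvoo; rewrite in_itv.
  by apply: filterS => u; rewrite /= in_itv /= => /fz.
have dz (w : R * R -> R) t : a < t < b -> derive1 (w \o f) t = 0.
  move=> tab; apply: derive1_val.
  apply: near_eq_is_derive (is_derive_const (w z) t).
  by apply: filterS (nearz t tab) => u /= <-.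
have -> : \int[lebesgue_measure]_(t in `]a, b[) ((f t).1 * derive1 (snd \o f) t -
    (f t).2 * derive1 (fst \o f) t) = \int[lebesgue_measure]_(t in `]a, b[) 0.
  apply: eq_Rintegral => t; rewrite inE /= in_itv /= => tab.
  by rewrite !dz // !mulr0 subrr.
by rewrite /Rintegral integral0 mulr0.
Qed.

Section Main.
Context {R : realType} {n : nat} {P : nat -> R * R} (HP : cppos n P).
Context {p : R * R} (hp : forall k, 0 < height P k p).
Implicit Types (i j k : nat) (a b t : R).
Local Notation q := (qfun n P p).
Local Notation ld := (left_derivative q).
Local Notation rd := (right_derivative q).

Section Breaks.
Context {m : nat} {d : nat -> R} (m0 : (0 < m)%N) (d0 : d 0%N = 0) (dm : d m = pi)
  (dlt : forall k, (k < m)%N -> d k < d k.+1)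
  (d_transition : forall k, (0 < k < m)%N -> transition n P p (d k))
  (d_between : forall k t, (k < m)%N -> d k < t < d k.+1 -> ~ transition n P p t)
  (d_cover : forall t, transitions n P p t -> exists2 k, (k < m)%N & t = d k).

Lemma break_piece k : (k < m)%N -> @piece R q (d k) (d k.+1).
Proof.
move=> km; have [i [j cell]] := nontransition_cell HP hp (dlt km) (fun t =>
  d_between km (t := t)).
exact: (cell_piece HP hp cell).
Qed.

Lemma break_inner k : (k <= m)%N -> 0 < d k < pi -> transition n P p (d k).
Proof.
move=> km /andP[dk0 dkp]; apply: d_transition.
have kn0 : k <> 0%N by move=> k0; move: dk0; rewrite k0 d0 ltxx.
have knm : k <> m by move=> k1; move: dkp; rewrite k1 dm ltxx.
lia.
Qed.

(** A maximal interval with fixed sides contains no break point, and cannot be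
    enlarged beyond one. *)
Lemma cellsE : cells n P p = [set` [seq (d k, d k.+1) | k <- iota 0 m]].
Proof.
apply/seteqP; split=> [[a b] [/= a0 ab bp fs mx]|_ /mapP [k + ->]] /=; last first.
  rewrite mem_iota add0n => /= km; have /andP[h1 h2] := break_itv d0 dm dlt (ltnW km).
  have /andP[h3 h4] := break_itv d0 dm dlt km.
  split=> //=; first exact: dlt.
    by apply: nontransition_fixed_sides => //; [exact: dlt|move=> t; exact: d_between].
  move=> a b /andP[a0 ak] /andP[kb bp] fs.
  have nt := fixed_sides_nontransition HP hp fs.
  have akE : a = d k.
    apply/eqP; rewrite eq_le ak leNgt; apply/negP => lt.
    have kab : a < d k < b by rewrite lt (lt_le_trans (dlt km) kb).
    apply: (nt _ kab); apply: break_inner; first exact: ltnW.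
    by rewrite (le_lt_trans a0 lt) (lt_le_trans (dlt km) h4).
  have kbE : b = d k.+1.
    apply/eqP; rewrite eq_le kb andbT leNgt; apply/negP => lt.
    have kab : a < d k.+1 < b by rewrite lt (le_lt_trans ak (dlt km)).
    apply: (nt _ kab); apply: break_inner => //.
    by rewrite (le_lt_trans h1 (dlt km)) (lt_le_trans lt bp).
  by rewrite akE kbE.
have nt := fixed_sides_nontransition HP hp fs.
have mp : 0 <= (a + b) / 2 <= pi by apply/andP; split; lra.
have [k [km /andP[k1 k2]]] := break_locate m0 d0 dm mp.
have ka : d k <= a.
  rewrite leNgt; apply/negP => lt; have kab : a < d k < b by rewrite lt /=; lra.
  apply: (nt _ kab); apply: break_inner; first exact: ltnW.
  by case/andP: kab => h1 h2; rewrite (le_lt_trans a0 h1) (lt_le_trans h2 bp).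
have kb : b <= d k.+1.
  rewrite leNgt; apply/negP => lt; have kab : a < d k.+1 < b by rewrite lt andbT; lra.
  apply: (nt _ kab); apply: break_inner => //.
  by case/andP: kab => h1 h2; rewrite (le_lt_trans a0 h1) (lt_le_trans h2 bp).
have /andP[h1 h2] := break_itv d0 dm dlt (ltnW km).
have /andP[h3 h4] := break_itv d0 dm dlt km.
have fk : fixed_sides n P p (d k) (d k.+1).
  by apply: nontransition_fixed_sides => //; [exact: dlt|move=> t; exact: d_between].
have := mx (d k) (d k.+1); rewrite h1 ka kb h4 => /(_ isT isT fk) [<- <-].
by apply/mapP; exists k; rewrite ?mem_iota.
Qed.

Lemma break_inj k k' : (k < m)%N -> (k' < m)%N -> d k = d k' -> k = k'.
Proof.
move=> km km' E; have [lt|lt|//] := ltngtP k k'.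
  by have := break_lt dlt (i := k) (j := k'); rewrite lt ltnW // E ltxx => /(_ isT).
by have := break_lt dlt (i := k') (j := k); rewrite lt ltnW // E ltxx => /(_ isT).
Qed.

Lemma sum_cells (f : R -> R -> R) :
  \sum_(I \in cells n P p) f I.1 I.2 = \sum_(0 <= k < m) f (d k) (d k.+1).
Proof.
rewrite cellsE -fsbig_seq; first by rewrite big_map /index_iota subn0.
rewrite map_inj_in_uniq ?iota_uniq // => k k'; rewrite !mem_iota !add0n /= => km km' [E _].
exact: break_inj.
Qed.

(** The break point [0] may fail to be a transition; the segment there is then
    reduced to a point, and its area is [0]. *)
Lemma sum_transitions :
  \sum_(t \in transitions n P p) arc_area (ART_segment n P p t) 0 1 =
  \sum_(0 <= k < m) arc_area (lerp (@corner R q p (d k) (ld (d k))) (@corner R q p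
    (d k) (rd (d k)))) 0 1.
Proof.
have uD : uniq [seq d k | k <- iota 0 m].
  rewrite map_inj_in_uniq ?iota_uniq // => k k'; rewrite !mem_iota !add0n /= => km km'.
  exact: break_inj.
transitivity (\sum_(t \in [set` [seq d k | k <- iota 0 m]]) arc_area
  (ART_segment n P p t) 0 1).
  apply: fsbig_widen => t.
    by move=> /d_cover [k km ->]; apply/mapP; exists k; rewrite ?mem_iota.
  move=> [/mapP [k]]; rewrite mem_iota add0n => /= km -> nt.
  rewrite /preimage /= /ART_segment -/(@corner R q p (d k) (ld (d k)))
    -/(@corner R q p (d k) (rd (d k))) corner_area (nontransition_smooth HP hp).
    by rewrite subrr mulr0.
  move=> tr; apply: nt; split=> //; have /andP[h1 h2] := break_itv d0 dm dlt (ltnW km).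
  by rewrite /= in_itv /= h1 -dm (break_lt dlt) // km leqnn.
by rewrite -fsbig_seq // big_map /index_iota subn0.
Qed.

Lemma ART_areaE : ART_area n P p =
  2^-1 * \sum_(0 <= k < m) @cell_energy R q (d k) (d k.+1).
Proof.
rewrite /ART_area (sum_cells (arc_area (envelope n P p))) sum_transitions.
by have := front_area p (qfunDpi HP hp) m0 d0 dm dlt break_piece.
Qed.

Lemma ART_area_energy : ART_area n P p = 2^-1 * \sum_(I \in cells n P p)
  \int[lebesgue_measure]_(t in `]I.1, I.2[) ((q t) ^+ 2 - (derive1 q t) ^+ 2).
Proof. by rewrite ART_areaE (sum_cells (@cell_energy R q)). Qed.

Lemma ART_area_le0 : ART_area n P p <= 0.
Proof.
rewrite ART_areaE; have qpi := qfunDpi HP hp.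
have [c c01 qc] := support_zero qpi d0 dm dlt break_piece.
by rewrite pmulr_rle0 ?invr_gt0 // (energy_le0 qpi d0 dm dlt break_piece c01 qc).
Qed.

Lemma ART_area_eq0 : ART_area n P p = 0 ->
  exists A c, forall t, 0 <= t <= pi -> q t = A * sin (t - c).
Proof.
rewrite ART_areaE => /eqP; rewrite mulf_eq0 invr_eq0 pnatr_eq0 /= => /eqP E0.
have qpi := qfunDpi HP hp.
have [c c01 qc] := support_zero qpi d0 dm dlt break_piece.
have [A AE] := energy_eq0 qpi m0 d0 dm dlt break_piece c01 qc E0.
by exists A, c.
Qed.

End Breaks.

(** A multiple of a shifted sine is the support function of a point, here seen
    from [p]. *)
Lemma point_ART A c : (forall t, 0 <= t <= pi -> q t = A * sin (t - c)) ->
  ART n P p = [set (p + A *: (- sin c, cos c) : R * R)].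
Proof.
move=> q_sine; set z := (X in [set X]); pose g t := A * sin (t - c).
(* Antiperiodicity extends the formula to the left of 0, where the left
   derivative at 0 is taken. *)
have qg t : - pi <= t <= pi -> q t = g t.
  move=> /andP[t1 t2]; have [t0|t0] := leP 0 t; first by rewrite q_sine // t0.
  have := qfunDpi HP hp t; rewrite q_sine; last by apply/andP; split; lra.
  have -> : t + pi - c = (t - c) + pi by ring.
  by rewrite sinDpi /g mulrN => /oppr_inj.
have dg t : is_derive t 1 g (A * cos (t - c)).
  have ds := @is_derive_comp _ sin (fun x => x - c) t _ _ (is_derive_sin (t - c))
    (is_derive_add (is_derive_id t 1) (is_derive_const (- c) t)).
  have := is_derive_mul (is_derive_const A t) ds.
  by rewrite mul0r add0r addr0 mulr1.
have zE t : p + g t *: nvec t + (A * cos (t - c)) *: tvec t = z.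
  have cs : cos t * cos t + sin t * sin t = 1 by rewrite -!expr2 cos2Dsin2.
  rewrite /z /g /nvec /tvec sinB cosB; apply: plane_eq; coords.
    transitivity (p.1 - A * sin c * (cos t * cos t + sin t * sin t)); first by ring.
    by rewrite cs; ring.
  transitivity (p.2 + A * cos c * (cos t * cos t + sin t * sin t)); first by ring.
  by rewrite cs; ring.
have p0 := pi_gt0 R.
have env t : 0 <= t < pi -> envelope n P p t = z.
  move=> /andP[t0 tp]; have tI : - pi < t < pi by apply/andP; split; lra.
  have tI' : - pi <= t <= pi by case/andP: tI => *; rewrite !ltW.
  rewrite /envelope; have -> : derive1 q t = A * cos (t - c).
    apply: derive1_val; apply: near_eq_is_derive (dg t).
    have : nbhs t `]- pi, pi[%classic by apply: near_in_itvoo; rewrite in_itv.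
    by apply: filterS => u; rewrite /= in_itv /= => /andP[u1 u2]; rewrite qg // !ltW.
  by rewrite qg // zE.
have envl t : 0 <= t < pi -> envelope_left n P p t = z.
  move=> /andP[t0 tp]; rewrite /envelope_left.
  have tl : - pi < t by lra.
  rewrite (@left_derivative_piece _ q g (- pi) t _ tl _ (dg t)).
    by rewrite qg ?zE //; apply/andP; split; lra.
  by move=> u /andP[u1 u2]; apply: qg; rewrite u1 (le_trans u2) // ltW.
have envr t : 0 <= t < pi -> envelope_right n P p t = z.
  move=> /andP[t0 tp]; rewrite /envelope_right.
  rewrite (@right_derivative_piece _ q g t pi _ tp _ (dg t)).
    by rewrite qg ?zE //; apply/andP; split; lra.
  by move=> u /andP[u1 u2]; apply: qg; rewrite u2 andbT; lra.
have segE t s : 0 <= t < pi -> ART_segment n P p t s = z.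
  by move=> tp; rewrite /ART_segment envl // envr // /lerp subrr scaler0 addr0.
have z0 : 0 <= (0 : R) < pi by rewrite lexx.
apply/seteqP; split=> w.
  move=> [[t [tp _] <-]|[t [_ tp] [s _ <-]]].
    by apply: env; move: tp; rewrite /= in_itv.
  by apply: segE; move: tp; rewrite /= in_itv.
move=> ->; have [tr|nt] := pselect (transition n P p 0).
  right; exists 0; first by split; rewrite //= in_itv.
  by exists 0; [rewrite /= in_itv /= lexx ler01|exact: segE].
by left; exists 0; [split; rewrite //= in_itv|exact: env].
Qed.

(** Every arc and every inserted segment is constant, so all areas vanish
    before any summation formula is used. *)
Lemma ART_area_point z : ART n P p = [set z] -> ART_area n P p = 0.
Proof.
move=> Az; rewrite /ART_area.
have memz w : ART n P p w -> w = z by rewrite Az.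
rewrite fsbig1 ?add0r.
  apply: fsbig1 => t [tr tp].
  have sz s : 0 <= s <= 1 -> ART_segment n P p t s = z.
    by move=> s01; apply: memz; right; exists t => //; exists s => //; rewrite /= in_itv.
  apply: (@arc_area_const _ _ _ _ z) => s /andP[s0 s1].
  by apply: sz; rewrite !ltW.
move=> [a b] [/= a0 ab bp fs _]; apply: (@arc_area_const _ _ _ _ z) => t tab.
apply: memz; left; exists t => //; split.
  by case/andP: tab => ta tb; rewrite /= in_itv /= (le_trans a0 (ltW ta))
    (lt_le_trans tb bp).
exact (fixed_sides_nontransition HP hp fs tab).
Qed.

End Main.

Unset Implicit Arguments.

Theorem theorem6p17 (R : realType) (n : nat) (P : nat -> R * R)
    (HP : cppos n P) (p : R * R) (Hp : interior (region P) p) :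
  [/\ ART_area n P p =
        2^-1 * \sum_(I \in cells n P p)
          \int[lebesgue_measure]_(t in `]I.1, I.2[)
            ((qfun n P p t) ^+ 2 - (derive1 (qfun n P p) t) ^+ 2),
      ART_area n P p <= 0
    & ART_area n P p = 0 <-> exists z : R * R, ART n P p = [set z]].
Proof.
have hp := interior_height HP Hp.
have [m [d [m0 d0 dm dlt [dtr dbt dcov]]]] := breakpoints HP hp.
split.
- exact: (ART_area_energy HP hp m0 d0 dm dlt dtr dbt dcov).
- exact: (ART_area_le0 HP hp m0 d0 dm dlt dtr dbt dcov).
split=> [E0|[z Az]]; last exact: (ART_area_point HP hp Az).
have [A [c q_sine]] := ART_area_eq0 HP hp m0 d0 dm dlt dtr dbt dcov E0.
by eexists; exact: (point_ART HP hp q_sine).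
Qed.
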